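(* For every integer $\alpha\geq 2$ there exists a non-smooth vector field (NSVF) $Z$ such that its topological entropy satisfies $h(Z)=\log\alpha$.
   Context: NSVF. Let $U\subset\mathbb{R}^2$ be open (or a 2-dimensional surface) and $f$ a real-valued $C^r$ function ($r>1$ large enough) having $0$ as a regular value; $\Sigma=f^{-1}(0)\cap U$, $\Sigma^{+}=\{q\in U: f(q)>0\}$, $\Sigma^{-}=\{q\in U: f(q)<0\}$. A NSVF $Z=(X,Y)$ is given by $Z=X$ on $\Sigma^+$ and $Z=Y$ on $\Sigma^-$, where $X,Y$ are $C^r$ vector fields on $\overline{\Sigma^+}$, $\overline{\Sigma^-}$ (extendable to $C^r$ vector fields on open sets containing them), with flows $\phi_X,\phi_Y$. Put $Xf(p)=\langle\nabla f(p),X(p)\rangle$, $X^2f(p)=\langle\nabla (Xf)(p),X(p)\rangle$, and similarly for $Y$. Regions of $\Sigma$: $\Sigma^{c+}=\{Xf>0,Yf>0\}$, $\Sigma^{c-}=\{Xf<0,Yf<0\}$ (crossing); $\Sigma^{s}=\{Xf<0,Yf>0\}$ (sliding); $\Sigma^{e}=\{Xf>0,Yf<0\}$ (escaping). A tangency point is $p\in\Sigma$ with $Xf(p)\,Yf(p)=0$. A fold of $X$ is a point with $Xf(p)=0\ne X^2f(p)$; it is visible if $X^2f(p)>0$ and invisible if $X^2f(p)<0$; for $Y$ the two inequalities are interchanged. A tangency point is singular if it is an invisible tangency for both $X$ and $Y$, and regular otherwise. The sliding vector field on $\Sigma^s\cup\Sigma^e$ is $Z^s=\dfrac{(Yf)X-(Xf)Y}{Yf-Xf}$,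 extended to $\overline{\Sigma^s}\cup\overline{\Sigma^e}$. Local trajectories through $p$ ($t$ in an interval $I\ni 0$, origin of time at $p$; $\phi_X$, $\phi_Y$, $\phi_{Z^s}$ are followed while they remain in $\overline{\Sigma^+}$, $\overline{\Sigma^-}$, $\overline{\Sigma^s}\cup\overline{\Sigma^e}$ respectively): (i) $\phi_X$ if $p\in\Sigma^+$, $\phi_Y$ if $p\in\Sigma^-$; (ii) if $p\in\Sigma^{c+}$: $\phi_Y$ for $t\le0$ and $\phi_X$ for $t\ge0$; if $p\in\Sigma^{c-}$ the same reversing time; (iii) if $p\in\Sigma^e$: $\phi_{Z^s}$ for $t\le 0$ and any one of $\phi_X,\phi_Y,\phi_{Z^s}$ for $t\ge0$; if $p\in\Sigma^s$ the same reversing time; (iv) if $p$ is a regular tangency: $\phi_1$ for $t\le0$ and $\phi_2$ for $t\ge0$, each of $\phi_1,\phi_2$ being any of $\phi_X,\phi_Y,\phi_{Z^s}$; (v) if $p$ is a singular tangency: constantly $p$ for all $t\in\mathbb{R}$. A global trajectory is a curve $\gamma$ defined on $\mathbb{R}$ that is an orientation-preserving concatenation of local trajectories $\sigma_i$ on $[t_i,t_{i+1}]$, $i\in\mathbb{Z}$, with matching endpoints and $t_i\to\pm\infty$ as $i\to\pm\infty$. A set $A$ is $Z$-invariant if every maximal trajectory through any point of $A$ is contained in $A$. Entropy of a map. For a continuous self-map $g$ of a metric space $(W,d)$ let $d_n^g(x,y)=\max_{0\le i\le n-1}d(g^i(x),g^i(y))$, let $S_d(g,\varepsilon,n)$ be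 the minimal cardinality of a set $E\subset W$ such that the open $d^g_n$-balls of radius $\varepsilon$ centered at points of $E$ cover $W$, and $h(g)=\lim_{\varepsilon\to0}\limsup_{n\to\infty}\frac1n\log S_d(g,\varepsilon,n)$. Entropy of a NSVF. Let $Z$ be a NSVF considered on a compact phase space $M$ (a compact surface, or a compact $Z$-invariant set in the plane to which $Z$ is restricted). Let $\Omega$ be the set of all global trajectories of $Z$ in $M$, with metric $\rho(\gamma_1,\gamma_2)=\sum_{i\in\mathbb{Z}}2^{-|i|}\int_i^{i+1}|\gamma_1(t)-\gamma_2(t)|\,dt$, where $|\gamma_1(t)-\gamma_2(t)|$ is the distance between the points. Let $F_1:\Omega\to\Omega$, $F_1(\gamma)(\cdot)=\gamma(\cdot+1)$. Then $h(Z):=h(F_1)$. *)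

(* Defs.v *)
From mathcomp Require Import all_boot all_order all_algebra.
From mathcomp Require Import all_classical all_reals all_analysis.

Set Implicit Arguments.
Unset Strict Implicit.
Unset Printing Implicit Defensive.

Import Order.TTheory GRing.Theory Num.Theory.
Import numFieldNormedType.Exports.

Local Open Scope classical_set_scope.
Local Open Scope ring_scope.

Notation plane R := 'rV[R]_2.

Section Plane.
Variable R : realType.
Implicit Types (p q v : plane R) (h : plane R -> R) (V : plane R -> plane R).

Definition dot p q : R := \sum_(i < 2) p 0 i * q 0 i.

(* The library norm on row vectors is the sup norm, hence an explicit
   Euclidean distance. *)
Definition dist p q : R := Num.sqrt (dot (p - q) (p - q)).

Definition grad h p : plane R := \row_(i < 2) 'D_(delta_mx 0 i) h p.

(* C^k on an open set [O]. *)
Fixpoint Ck (k : nat) (O : set (plane R)) h : Prop :=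
  match k with
  | 0 => forall p, O p -> {for p, continuous h}
  | k'.+1 => (forall p, O p -> differentiable h p) /\
             forall i : 'I_2, Ck k' O (fun p => 'D_(delta_mx 0 i) h p)
  end.

Definition Ck_field (k : nat) (O : set (plane R)) V : Prop :=
  forall i : 'I_2, Ck k O (fun p => V p 0 i).

(* The derivative [Vh] of [h] along [V]. *)
Definition lie V h p : R := dot (grad h p) (V p).

End Plane.

(* [fieldX] and [fieldY] are C^r extensions to open sets: only their values on
   the closures (in [domain]) of the two open regions are used below.  At points
   of the switching curve, the one-sided values determine [X(Xf)] as well. *)
Record nsvf (R : realType) (r : nat) := Nsvf {
  domain : set (plane R);
  switch : plane R -> R;
  fieldX : plane R -> plane R;
  fieldY : plane R -> plane R;
  domain_open : open domain;
  switch_Cr : Ck r domain switch;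
  switch_regular : forall p, domain p -> switch p = 0 -> grad switch p != 0;
  fieldX_Cr : exists O : set (plane R), [/\ open O,
    closure [set q | domain q /\ 0 < switch q] `&` domain `<=` O &
    Ck_field r O fieldX];
  fieldY_Cr : exists O : set (plane R), [/\ open O,
    closure [set q | domain q /\ switch q < 0] `&` domain `<=` O &
    Ck_field r O fieldY]
}.

Section Trajectories.
Variables (R : realType) (r : nat) (Z : nsvf R r).
Implicit Types (p q v : plane R) (I J : set R) (gam : R -> plane R).

Local Notation U := (domain Z).
Local Notation f := (switch Z).
Local Notation X := (fieldX Z).
Local Notation Y := (fieldY Z).

Definition Sigma : set (plane R) := [set p | U p /\ f p = 0].
Definition Sigma_plus : set (plane R) := [set p | U p /\ 0 < f p].
Definition Sigma_minus : set (plane R) := [set p | U p /\ f p < 0].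

Definition Xf := lie X f.
Definition Yf := lie Y f.
Definition X2f := lie X Xf.
Definition Y2f := lie Y Yf.

Definition crossing_plus : set (plane R) :=
  [set p | [/\ Sigma p, 0 < Xf p & 0 < Yf p]].
Definition crossing_minus : set (plane R) :=
  [set p | [/\ Sigma p, Xf p < 0 & Yf p < 0]].
Definition sliding : set (plane R) :=
  [set p | [/\ Sigma p, Xf p < 0 & 0 < Yf p]].
Definition escaping : set (plane R) :=
  [set p | [/\ Sigma p, 0 < Xf p & Yf p < 0]].

Definition tangency p : Prop := Sigma p /\ Xf p * Yf p = 0.
Definition invisible_X p : Prop := Xf p = 0 /\ X2f p < 0.
Definition invisible_Y p : Prop := Yf p = 0 /\ 0 < Y2f p.
Definition singular_tangency p : Prop :=
  [/\ tangency p, invisible_X p & invisible_Y p].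
Definition regular_tangency p : Prop :=
  tangency p /\ ~ singular_tangency p.

Definition Zs p : plane R :=
  (Yf p - Xf p)^-1 *: (Yf p *: X p - Xf p *: Y p).

(* [Zs_ext p v]: the extension of [Zs] by continuity takes the value [v] at [p].
   On the sliding and escaping regions this just means [v = Zs p]; it matters at
   boundary points with [Xf p = Yf p = 0], where the formula is 0/0. *)
Definition Zs_ext p v : Prop :=
  Zs q @[q --> within (sliding `|` escaping) (nbhs p)] --> v.

Inductive regime := FlowX | FlowY | FlowZs.

Definition region (m : regime) : set (plane R) :=
  match m with
  | FlowX => closure Sigma_plus `&` U
  | FlowY => closure Sigma_minus `&` U
  | FlowZs => (closure sliding `|` closure escaping) `&` U
  end.

Definition velocity (m : regime) p v : Prop :=
  match m with
  | FlowX => v = X p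
  | FlowY => v = Y p
  | FlowZs => Zs_ext p v
  end.

(* On the interval [I], [gam] is an orbit of [phi_X], [phi_Y] or [phi_Zs] which
   remains in the corresponding region.  The equation is imposed in the interior
   of [I]; by continuity it holds one-sidedly at the endpoints. *)
Definition follows (m : regime) I gam : Prop :=
  [/\ forall t, I t -> region m (gam t),
      {within I, continuous gam} &
      forall t, interior I t -> exists2 v, velocity m (gam t) v & is_derive t 1 gam v].

Definition past I : set R := [set t | I t /\ t <= 0].
Definition future I : set R := [set t | I t /\ 0 <= t].

Variant local_law p I gam : Prop :=
  | law_plus of Sigma_plus p & follows FlowX I gam
  | law_minus of Sigma_minus p & follows FlowY I gam
  | law_crossing_plus of crossing_plus p
      & follows FlowY (past I) gam & follows FlowX (future I) gam
  | law_crossing_minus of crossing_minus p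
      & follows FlowX (past I) gam & follows FlowY (future I) gam
  | law_escaping m of escaping p
      & follows FlowZs (past I) gam & follows m (future I) gam
  | law_sliding m of sliding p
      & follows m (past I) gam & follows FlowZs (future I) gam
  | law_regular m1 m2 of regular_tangency p
      & follows m1 (past I) gam & follows m2 (future I) gam
  | law_singular of singular_tangency p & (forall t, I t -> gam t = p).

Definition local_trajectory p I gam : Prop :=
  [/\ is_interval I, I 0, gam 0 = p & local_law p I gam].

(* On [a, b], [gam] is a time translate of a local trajectory, whose base point
   is reached at time [s]. *)
Definition arc (a b : R) gam : Prop :=
  exists2 s, a <= s <= b &
    local_trajectory (gam s) `[a - s, b - s] (fun u => gam (s + u)).

Definition global_trajectory gam : Prop :=
  exists t : int -> R,
    [/\ forall i : int, t i < t (i + 1) /\ arc (t i) (t (i + 1)) gam,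
        t n%:Z @[n --> \oo] --> +oo &
        t (- n%:Z) @[n --> \oo] --> -oo].

(* Trajectories on an arbitrary interval: locally finite concatenations of
   local trajectories. *)
Definition trajectory I gam : Prop :=
  [/\ is_interval I, forall t, I t -> U (gam t) &
      forall a b, I a -> I b -> a < b ->
        exists (n : nat) (t : nat -> R),
          [/\ t 0%N = a, t n = b &
              forall i, (i < n)%N ->
                t i < t i.+1 /\ arc (t i) (t i.+1) gam]].

Definition maximal_trajectory I gam : Prop :=
  trajectory I gam /\
  forall J gam', trajectory J gam' -> I `<=` J ->
    (forall t, I t -> gam' t = gam t) -> J = I.

Definition Z_invariant (A : set (plane R)) : Prop :=
  forall I gam, maximal_trajectory I gam ->
    (exists2 t, I t & A (gam t)) -> forall t, I t -> A (gam t).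

Definition Omega (M : set (plane R)) : set (R -> plane R) :=
  [set gam | global_trajectory gam /\ forall t, M (gam t)].

End Trajectories.

(* Entropy of a self-map [g] of the metric space given by a subset [W] of [T]
   stable under [g] and a distance [d]. *)
Section Entropy.
Variables (R : realType) (T : Type).
Variables (W : set T) (d : T -> T -> R) (g : T -> T).

Definition bowen_dist (n : nat) (x y : T) : R :=
  \big[Num.max/0]_(i < n) d (iter i g x) (iter i g y).

Definition spanning (eps : R) (n : nat) (E : set T) : Prop :=
  E `<=` W /\ forall y, W y -> exists2 x, E x & bowen_dist n x y < eps.

(* Equal to +oo when no finite set is spanning. *)
Definition min_spanning (eps : R) (n : nat) : \bar R :=
  ereal_inf [set (k%:R)%:E | k in
    [set k : nat | exists2 E : set T, (E #= `I_k)%card & spanning eps n E]].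

Definition entropy_at (eps : R) : \bar R :=
  limn_esup (fun n : nat => (((n%:R)^-1)%:E * lne (min_spanning eps n))%E).

Definition map_entropy : \bar R := lim (entropy_at eps @[eps --> 0^'+]).

End Entropy.

Section NsvfEntropy.
Variable R : realType.
Implicit Types gam : R -> plane R.

Definition rho gam1 gam2 : R :=
  fine (\esum_(i in [set: int])
    ((2 ^- `|i|%N)%:E *
     \int[lebesgue_measure]_(t in `[(i%:~R : R), (i + 1)%:~R])
       (dist (gam1 t) (gam2 t))%:E)%E).

Definition F1 gam : R -> plane R := fun t => gam (t + 1).

Definition nsvf_entropy (r : nat) (Z : nsvf R r) (M : set (plane R)) : \bar R :=
  map_entropy (Omega Z M) rho F1.

End NsvfEntropy.

(* Main.v *)
(** The switching curve is [y = 0], and with [P x = x^2 (1 - x^2)] the fields are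
   [X = c (1, P' x)] and [Y = c (-1, P' x)], so that [X f = Y f] and there is
   neither sliding nor escaping.  The curve [y = P x] is an orbit of [X] and
   [y = - P x] one of [Y]; together, over [-1 <= x <= 1], they form a figure
   eight which crosses the switching curve at [(1, 0)] and [(-1, 0)], and whose
   node [(0, 0)] is a visible fold of both fields.  A trajectory may leave the
   node along either loop, each loop takes time [2 / c], and no other choice is
   available: the trajectories on the figure eight are the itineraries
   coded by a bi-infinite sequence of signs and an initial phase.  The time-one
   map thus has entropy [(c / 2) ln 2], and [c = 2 ln alpha / ln 2] is chosen. *)

Require Import Defs.
From mathcomp Require Import all_boot all_order all_algebra.
From mathcomp Require Import all_classical all_reals all_analysis.
From mathcomp Require Import measurable_realfun.
From mathcomp Require Import ring lra.

Set Implicit Arguments.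
Unset Strict Implicit.
Unset Printing Implicit Defensive.

Import Order.TTheory GRing.Theory Num.Theory.
Import numFieldNormedType.Exports.

Local Open Scope classical_set_scope.
Local Open Scope ring_scope.

(** The profile [P] has a double zero at [0], with [P'' 0 > 0], which makes the node a visible fold,
    and simple zeros at [1] and [-1], which make the tips transversal crossings. Horizontal speed is
    constant, so [y - P x] and [y + P x] are first integrals of [X] and [Y]. Orbits are not unique,
    and the pieces of a trajectory may be cut and based anywhere. The local laws are therefore
    forgotten: an arc is kept only as at most two flow lines, each confined to its closed
    half-plane. Since [P x < 0] for [x^2 > 1], this sign constraint alone confines the motion to the
    figure eight and forces it to change sides at the tips. Only the node leaves a choice. The
    phase, an angle modulo [2], grows at rate [c] along both loops, so timing and choice of loops
    decouple. For every small [eps], the spanning number of order [n] is [2^(c n / 2)] up to a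
    factor that does not depend on [n], so the entropy at scale [eps] is already the final value.
    The lower bound uses [c >= 2], which is where [alpha >= 2] enters. *)

Section Coordinates.
Variable R : realType.
Implicit Types (p q v : plane R) (h : {poly R}).

(** * Coordinates of the plane, polynomials in one coordinate, half-planes *)

Definition vec (x y : R) : plane R := \row_(i < 2) if i == 0 then x else y.

Lemma vec0 x y : vec x y 0 0 = x. Proof. by rewrite mxE. Qed.
Lemma vec1 x y : vec x y 0 1 = y. Proof. by rewrite mxE. Qed.
Definition vecE := (vec0, vec1).

Lemma plane_eqP p q : p 0 0 = q 0 0 -> p 0 1 = q 0 1 -> p = q.
Proof.
move=> e0 e1; apply/rowP => -[[|[|//]] lti].
  by rewrite (_ : Ordinal lti = 0) //; exact: val_inj.
by rewrite (_ : Ordinal lti = 1) //; exact: val_inj.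
Qed.

Lemma dotE p q : dot p q = p 0 0 * q 0 0 + p 0 1 * q 0 1.
Proof.
rewrite /dot big_ord_recl big_ord1.
by rewrite (_ : lift ord0 ord0 = 1) //; exact: val_inj.
Qed.

Lemma dist_ge_coord p q i : `|p 0 i - q 0 i| <= dist p q.
Proof.
rewrite -sqrtr_sqr /dist ler_wsqrtr // /dot (bigD1 i) //= !mxE -expr2.
by rewrite lerDl sumr_ge0 // => j _; rewrite -expr2 sqr_ge0.
Qed.

Lemma dist_le_coord p q :
  dist p q <= `|p 0 0 - q 0 0| + `|p 0 1 - q 0 1|.
Proof.
have ab0 : 0 <= `|p 0 0 - q 0 0| + `|p 0 1 - q 0 1| by rewrite addr_ge0.
rewrite -[leRHS](ger0_norm ab0) -sqrtr_sqr ler_wsqrtr // dotE !mxE -!expr2.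
rewrite [leRHS]sqrrD !real_normK ?num_real //.
by rewrite lerD2r lerDl mulrn_wge0 // mulr_ge0.
Qed.

Lemma dist_ge0 p q : 0 <= dist p q. Proof. exact: sqrtr_ge0. Qed.

Lemma derive_coord p v (j : 'I_2) :
  'D_v (fun p : plane R => p 0 j) p = v 0 j.
Proof.
have := @derive_mx R _ 1 2 (fun p : plane R => p) p v (@derivable_id _ _ _ _).
by rewrite derive_id => e; rewrite [in RHS]e mxE.
Qed.

Lemma differentiable_horner_coord h (j : 'I_2) p :
  differentiable (fun p : plane R => h.[p 0 j]) p.
Proof.
apply: (@differentiable_comp _ _ _ _ (fun p : plane R => p 0 j) (horner h)).
  exact: differentiable_coord.
exact/derivable1_diffP/derivable_horner.
Qed.

Lemma derive_horner_coord h (i j : 'I_2) p :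
  'D_(delta_mx 0 i) (fun p : plane R => h.[p 0 j]) p =
  (h^`() *+ (i == j)).[p 0 j].
Proof.
have dh : differentiable (horner h) (p 0 j).
  exact/derivable1_diffP/derivable_horner.
rewrite deriveE; last exact: differentiable_horner_coord.
rewrite (@diff_comp _ _ _ _ (fun p : plane R => p 0 j) (horner h)) //=; last first.
  exact: differentiable_coord.
rewrite diff1E // -deriveE; last exact: differentiable_coord.
rewrite derive_coord -derivE !mxE eqxx eq_sym.
by case: (i == j); rewrite ?mulr1n ?mulr0n ?horner0 ?scale1r ?scale0r.
Qed.

Lemma Ck_horner_coord k (O : set (plane R)) h (j : 'I_2) :
  Ck k O (fun p => h.[p 0 j]).
Proof.
elim: k h => [|k IH] h /=.
  by move=> p _; exact/differentiable_continuous/differentiable_horner_coord.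
split=> [p _|i]; first exact: differentiable_horner_coord.
rewrite (_ : (fun p => _) = (fun p => (h^`() *+ (i == j)).[p 0 j])).
  exact: IH.
by apply/funext => p; rewrite derive_horner_coord.
Qed.

Lemma closed_halfplane (a : R) (j : 'I_2) :
  closed [set p : plane R | 0 <= a * p 0 j].
Proof.
have -> : [set p : plane R | 0 <= a * p 0 j] =
    (fun p : plane R => a * p 0 j) @^-1` [set x | 0 <= x] by [].
apply: closed_comp; last exact: closed_ge.
move=> p _; apply: continuousM; first exact: cst_continuous.
exact: coord_continuous.
Qed.

Lemma closure_halfplane (a : R) p : a != 0 ->
  0 <= a * p 0 1 -> closure [set q : plane R | 0 < a * q 0 1] p.
Proof.
move=> a0 ap B /nbhs_ballP[e /= e0 eB].
(* A vertical step of length [e / 2] in the direction of the sign of [a]. *)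
exists (p + (e / 2 / `|a|) *: vec 0 a); split.
  rewrite /= !mxE /= mulrDr ltr_wpDl //.
  rewrite mulrCA mulr_gt0 ?divr_gt0 ?normr_gt0 //.
  by rewrite -expr2 lt_neqAle eq_sym sqrf_eq0 a0 sqr_ge0.
apply: eB; split=> // i j; rewrite /ball /= !mxE opprD addNKr normrN normrM.
rewrite ger0_norm ?divr_ge0 ?(ltW e0) //.
case: ifP => _; first by rewrite normr0 mulr0.
by rewrite divfK ?normr_eq0 // ltr_pdivrMr // ltr_pMr // ltr1n.
Qed.
End Coordinates.

(** * The vector field *)

Section Lens.
Variables (R : realType) (c : R).
Implicit Types (p q v : plane R) (gam : R -> plane R) (J : set R).

Definition profile : {poly R} := 'X^2 - 'X^4.

Definition lens_height p : R := p 0 1.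
Definition lens_X p : plane R := vec c (c * profile^`().[p 0 0]).
Definition lens_Y p : plane R := vec (- c) (c * profile^`().[p 0 0]).

Lemma profileE x : profile.[x] = x ^+ 2 * (1 - x ^+ 2).
Proof. rewrite !hornerE. ring. Qed.

Lemma profileN x : profile.[- x] = profile.[x].
Proof. by rewrite !profileE sqrrN. Qed.

Lemma lens_heightE : lens_height = fun p => 'X.[p 0 1].
Proof. by apply/funext => p; rewrite hornerX. Qed.

Lemma lens_height_Cr r : Ck r setT lens_height.
Proof. rewrite lens_heightE; exact: Ck_horner_coord. Qed.

Lemma grad_horner h j p :
  grad (fun p : plane R => h.[p 0 j]) p = h^`().[p 0 j] *: delta_mx 0 j.
Proof.
apply/rowP => i; rewrite /grad !mxE derive_horner_coord hornerMn eqxx /=.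
by case: (i == j); rewrite /= ?mulr1 ?mulr0.
Qed.

Lemma lens_height_regular p : grad lens_height p != 0.
Proof.
rewrite lens_heightE grad_horner derivX hornerC scale1r.
apply/eqP => /(congr1 (fun v : plane R => v 0 1)); rewrite !mxE /= => /eqP.
by rewrite oner_eq0.
Qed.

Lemma lens_field_Cr r a : Ck_field r setT (fun p => vec a (c * profile^`().[p 0 0])).
Proof.
move=> i; have [->|i0] := eqVneq i 0.
  rewrite (_ : (fun p => _) = (fun p => (a%:P).[p 0 0])).
    exact: Ck_horner_coord.
  by apply/funext => p; rewrite vecE hornerC.
rewrite (_ : (fun p => _) = (fun p => (c *: profile^`()).[p 0 0])).
  exact: Ck_horner_coord.
by apply/funext => p; rewrite !mxE (negPf i0) hornerZ.
Qed.

Definition lens r : nsvf R r :=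
  @Nsvf R r setT lens_height lens_X lens_Y openT (lens_height_Cr r)
    (fun p _ _ => lens_height_regular p)
    (ex_intro _ setT (And3 openT (fun _ _ => I) (lens_field_Cr r c)))
    (ex_intro _ setT (And3 openT (fun _ _ => I) (lens_field_Cr r (- c)))).

Variable r : nat.
Let Z := lens r.

Lemma lie_horner_coord V h j p :
  lie V (fun p : plane R => h.[p 0 j]) p = h^`().[p 0 j] * V p 0 j.
Proof.
rewrite /lie grad_horner dotE !mxE.
case: j => -[|[|//]] ltj.
  have -> : Ordinal ltj = 0 by exact: val_inj.
  by rewrite !eqxx /= mulr1 mulr0 mul0r addr0.
have -> : Ordinal ltj = 1 by exact: val_inj.
by rewrite !eqxx /= mulr1 mulr0 mul0r add0r.
Qed.

Lemma lens_Xf : Xf Z = fun p => (c *: profile^`()).[p 0 0].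
Proof.
apply/funext => p.
by rewrite /Xf /= lens_heightE lie_horner_coord derivX hornerC mul1r vecE hornerZ.
Qed.

Lemma lens_Yf : Yf Z = fun p => (c *: profile^`()).[p 0 0].
Proof.
apply/funext => p.
by rewrite /Yf /= lens_heightE lie_horner_coord derivX hornerC mul1r vecE hornerZ.
Qed.

Lemma lens_X2f p : X2f Z p = c ^+ 2 * profile^`()^`().[p 0 0].
Proof. rewrite /X2f lens_Xf lie_horner_coord vecE derivZ hornerZ. ring. Qed.

Lemma lens_sliding0 : sliding Z = set0.
Proof.
by rewrite -subset0 => p [_]; rewrite lens_Xf lens_Yf => /lt_trans h /h; rewrite ltxx.
Qed.

Lemma lens_escaping0 : escaping Z = set0.
Proof.
by rewrite -subset0 => p [_]; rewrite lens_Xf lens_Yf => /lt_trans h /h; rewrite ltxx.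
Qed.

Definition orient (b : bool) : R := if b then 1 else -1.
Definition flow b := if b then FlowX else FlowY.

Lemma lens_region b p : region Z (flow b) p <-> 0 <= orient b * p 0 1.
Proof.
have b0 : orient b != 0 by case: b; rewrite ?oppr_eq0 oner_eq0.
have -> : region Z (flow b) = closure [set q : plane R | 0 < orient b * q 0 1].
  case: b {b0} => /=; rewrite setIT; congr closure; apply/seteqP; split => q /=;
    rewrite /Sigma_plus /Sigma_minus /= /lens_height ?mul1r ?mulN1r ?oppr_gt0;
    by [case|move=> ?; split].
split=> [|yp]; last exact: closure_halfplane.
have /closure_id := @closed_halfplane R (orient b) 1.
by move/(congr1 (@^~ p)) => /= ->; apply: closureS => q /= /ltW.
Qed.

Lemma lens_region_Zs p : ~ region Z FlowZs p.
Proof. by case=> -[]; rewrite ?lens_sliding0 ?lens_escaping0 closure0. Qed.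

End Lens.

(** * Trajectories on the figure eight *)

Section Orbits.
Variables (R : realType) (c : R) (r : nat).
Implicit Types (p q v : plane R) (gam : R -> plane R) (J : set R).
Hypothesis c0 : 0 < c.
Let Z := lens c r.

(** The equation of the flow in integrated form: uniform horizontal motion, a first integral, and
    confinement to the half-plane. The two times are not ordered, so orbits can also be read
    backwards. *)
Definition flow_line b J gam := forall t t', J t -> J t' ->
  [/\ gam t' 0 0 - gam t 0 0 = orient R b * (c * (t' - t)),
      gam t' 0 1 - orient R b * (profile R).[gam t' 0 0] =
        gam t 0 1 - orient R b * (profile R).[gam t 0 0] &
      0 <= orient R b * gam t 0 1].

Lemma derivable_velocity gam (t : R) v i : is_derive t 1 gam v ->
  is_derive t 1 (fun t : R => gam t 0 i) (v 0 i).
Proof.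
move=> [dgam <-]; apply: DeriveDef; first by move/derivable_mxP : dgam; exact.
by rewrite derive_mx // mxE.
Qed.

Lemma follows_flow_line b J gam : is_interval J -> follows Z (flow b) J gam ->
  flow_line b J gam.
Proof.
move=> itvJ [reg cont der].
have lin t t' : J t -> J t' -> t < t' ->
    gam t' 0 0 - gam t 0 0 = orient R b * (c * (t' - t)) /\
      gam t' 0 1 - orient R b * (profile R).[gam t' 0 0] =
        gam t 0 1 - orient R b * (profile R).[gam t 0 0].
  move=> Jt Jt' tt'.
  have sJ : `[t, t']%classic `<=` J.
    by move=> s /=; rewrite in_itv /= => ?; exact: itvJ Jt Jt' _ _.
  have cJ : {within `[t, t'], continuous gam} by exact: continuous_subspaceW cont.
  have ci i : {within `[t, t'], continuous (fun s => gam s 0 i)}.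
    move=> s; apply: (@continuous_comp (subspace `[t, t']%classic) _ _ gam
      (fun p : plane R => p 0 i)); [exact: cJ|exact: coord_continuous].
  have di s i : s \in `]t, t'[%R -> is_derive s 1 (fun s => gam s 0 i)
      ((if b then lens_X c else lens_Y c) (gam s) 0 i).
    move=> st; have Js : interior J s.
      apply: filterS (near_in_itvoo st) => u ut.
      by apply: sJ; exact: subset_itv_oo_cc.
    have [w vw dw] := der _ Js.
    have -> : (if b then lens_X c else lens_Y c) (gam s) = w by case: b {reg der} vw.
    exact: derivable_velocity.
  split.
    have [s st ->] := MVT tt' (fun s => di s 0) (ci 0).
    by rewrite /orient; case: b {reg der di}; rewrite vecE ?mul1r ?mulN1r ?mulNr.
  (* The first integral: the vertical speed [c * P' x] is exactly the derivative of [orient b * P x]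
     along the horizontal speed [orient b * c]. *)
  set F := fun s => gam s 0 1 - orient R b * (profile R).[gam s 0 0].
  have dF s : s \in `]t, t'[%R -> is_derive s 1 F 0.
    move=> st.
    have d0 := di _ 0 st; have d1 := di _ 1 st.
    have d2 := @is_derive1_comp _ (horner (profile R)) (fun s => gam s 0 0) s _ _
      (is_derive_poly (profile R) _) d0.
    have := is_deriveB d1 (is_deriveZ (orient R b) d2).
    rewrite (_ : _ - _ = 0 :> R) //.
    by case: b {reg der di d0 d1 d2 F st}; rewrite !vecE /orient /GRing.scale /=; ring.
  have cF : {within `[t, t'], continuous F}.
    move=> s; apply: (@continuousB _ _ (subspace `[t, t']%classic)
      (fun s => gam s 0 1)); first exact: ci.
    apply: (@continuousM _ (subspace `[t, t']%classic) (cst (orient R b))).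
      exact: cst_continuous.
    apply: (@continuous_comp (subspace `[t, t']%classic) _ _
      (fun s => gam s 0 0) (horner (profile R))).
      exact: ci.
    exact: continuous_horner.
  have [s st] := MVT tt' dF cF.
  by rewrite mul0r => /eqP; rewrite subr_eq0 => /eqP.
move=> t t' Jt Jt'; have := reg _ Jt; rewrite lens_region => y0; split=> //.
- have [tt'|tt'|->] := ltgtP t t'.
  + by case: (lin _ _ Jt Jt' tt').
  + by case: (lin _ _ Jt' Jt tt') => + _; lra.
  + by rewrite !subrr !mulr0.
- have [tt'|tt'|-> //] := ltgtP t t'.
  + by case: (lin _ _ Jt Jt' tt').
  + by case: (lin _ _ Jt' Jt tt') => _ ->.
Qed.

Definition figure_eight : set (plane R) :=
  [set p | p 0 0 ^+ 2 <= 1 /\ p 0 1 ^+ 2 = (profile R).[p 0 0] ^+ 2].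

(** As [P >= 0] on [[-1, 1]], the sign of the ordinate selects the branch. Conversely, on the branch
    [P x >= 0], which excludes [x^2 > 1]. *)
Lemma figure_side b p : 0 <= orient R b * p 0 1 ->
  figure_eight p <-> p 0 1 = orient R b * (profile R).[p 0 0].
Proof.
rewrite /figure_eight /= profileE /orient => p1; split=> [[x1 /eqP]|yE].
  rewrite eqf_sqr; set y := p 0 1 in p1 *; set x := p 0 0 in x1 *.
  have P0 : 0 <= x ^+ 2 * (1 - x ^+ 2) by rewrite mulr_ge0 ?sqr_ge0 ?subr_ge0.
  by case: b p1 => ? /orP[/eqP|/eqP] ?; lra.
split; last by rewrite yE; case: b {p1 yE}; ring.
set x := p 0 0 in yE *; have : 0 <= x ^+ 2 * (1 - x ^+ 2).
  by move: p1; rewrite yE; case: b {yE} => ?; lra.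
case: (ltP 1 (x ^+ 2)) => // x1; rewrite pmulr_rge0; last exact: lt_trans x1.
by rewrite subr_ge0 leNgt x1.
Qed.

Lemma flow_line_figure b J gam t t' : flow_line b J gam -> J t -> J t' ->
  figure_eight (gam t) -> figure_eight (gam t').
Proof.
move=> orb Jt Jt'; have [_ H y0] := orb _ _ Jt Jt'; have [_ _ y0'] := orb _ _ Jt' Jt.
by rewrite (figure_side y0) (figure_side y0'); lra.
Qed.

Lemma lens_not_sliding p : ~ sliding Z p.
Proof. by rewrite lens_sliding0. Qed.

Lemma lens_not_escaping p : ~ escaping Z p.
Proof. by rewrite lens_escaping0. Qed.

Lemma follows_flow m J gam : is_interval J -> J !=set0 -> follows Z m J gam ->
  exists b, flow_line b J gam.
Proof.
move=> itvJ [t Jt]; case: m => fJ.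
- by exists true; exact: (@follows_flow_line true).
- by exists false; exact: (@follows_flow_line false).
- by case: fJ => /(_ _ Jt) /lens_region_Zs.
Qed.

(** The figure eight meets the switching curve only where [P = 0]: at the node, where [P'' > 0]
    makes the fold visible, and at the tips, where [P'] does not vanish. *)
Lemma singular_not_figure p : singular_tangency Z p -> ~ figure_eight p.
Proof.
case=> -[[_ /= p10]]; rewrite lens_Xf lens_Yf => /eqP; rewrite mulf_eq0 orbb => /eqP d0.
move=> [_ X2 _] [_]; move: p10 d0 X2; rewrite /= /lens_height => ->.
rewrite lens_X2f profileE expr0n /= => d0 X2 /esym /eqP; rewrite sqrf_eq0 mulf_eq0.
move: d0 X2; rewrite /profile !(derivB, derivXn, derivMn, hornerE) /=.
set x := p 0 0 => d0 X2.
case/orP => /eqP x2.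
  by move: X2; rewrite x2; nra.
have x0 : c * x = 0.
  apply: (mulfI (_ : 2 != 0 :> R)) => //.
  by move: d0; rewrite (_ : x ^+ 3 = x * x ^+ 2) ?exprS //; nra.
by move: x0 x2 => /eqP; rewrite mulf_eq0 gt_eqF //= => /eqP ->; rewrite expr0n /=; lra.
Qed.

(** Every law other than rest at a singular tangency yields one flow line on each side of the base
    point. Which flows the law allows is dropped, since the half-planes will determine it. *)
Lemma arc_flow_lines a b gam : Defs.arc Z a b gam ->
  (exists s b1 b2, [/\ a <= s <= b, flow_line b1 `[a, s] gam & flow_line b2 `[s, b] gam]) \/
  (exists2 p, singular_tangency Z p & forall t, a <= t <= b -> gam t = p).
Proof.
move=> [s /andP[asl slb] [itvI I0 _ law]].
have past_itv : is_interval (past `[a - s, b - s]).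
  move=> x y [/= + x0] [/= + y0] z; rewrite /past /= !in_itv /=. lra.
have future_itv : is_interval (future `[a - s, b - s]).
  move=> x y [/= + x0] [/= + y0] z; rewrite /future /= !in_itv /=. lra.
have past0 : past `[a - s, b - s] !=set0 by exists 0; split.
have future0 : future `[a - s, b - s] !=set0 by exists 0; split.
have shift b' J' J : (forall t, J t -> J' (t - s)) -> flow_line b' J' (fun u => gam (s + u)) ->
    flow_line b' J gam.
  move=> JJ' orb t t' /JJ' Jt /JJ' Jt'; have := orb _ _ Jt Jt'.
  have E x : s + (x - s) = x by ring.
  by rewrite !E (_ : t' - s - (t - s) = t' - t) //; ring.
have glue m1 m2 : follows Z m1 (past `[a - s, b - s]) (fun u => gam (s + u)) ->
    follows Z m2 (future `[a - s, b - s]) (fun u => gam (s + u)) ->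
    exists s b1 b2, [/\ a <= s <= b, flow_line b1 `[a, s] gam & flow_line b2 `[s, b] gam].
  move=> /(follows_flow past_itv past0)[b1 o1] /(follows_flow future_itv future0)[b2 o2].
  exists s, b1, b2; split; first by rewrite asl slb.
    by apply: shift o1 => t /=; rewrite /past /= !in_itv /=; lra.
  by apply: shift o2 => t /=; rewrite /future /= !in_itv /=; lra.
have whole m : follows Z m `[a - s, b - s] (fun u => gam (s + u)) ->
    exists s b1 b2, [/\ a <= s <= b, flow_line b1 `[a, s] gam & flow_line b2 `[s, b] gam].
  have nI : `[a - s, b - s]%classic !=set0 by exists 0.
  move=> /(follows_flow itvI nI)[b1 o1]; exists s, b1, b1; split; first by rewrite asl slb.
    by apply: shift o1 => t /=; rewrite !in_itv /=; lra.
  by apply: shift o1 => t /=; rewrite !in_itv /=; lra.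
case: law => [_ /whole|_ /whole|_ f1 f2|_ f1 f2|m /lens_not_escaping//
  |m /lens_not_sliding//|m1 m2 _ f1 f2|sg cst].
- by left.
- by left.
- by left; exact: glue f1 f2.
- by left; exact: glue f1 f2.
- by left; exact: glue f1 f2.
- right; exists (gam s) => // t tab; have := cst (t - s); rewrite [s + _]addrC subrK; apply.
  by rewrite /= in_itv /=; lra.
Qed.

Lemma arc_figure a b gam t t' : Defs.arc Z a b gam -> a <= t <= b -> a <= t' <= b ->
  figure_eight (gam t) -> figure_eight (gam t').
Proof.
have side b' x y z z' : flow_line b' `[x, y] gam -> x <= z <= y -> x <= z' <= y ->
    figure_eight (gam z) -> figure_eight (gam z').
  by move=> orb zxy z'xy; apply: (flow_line_figure orb); rewrite /= in_itv.
move=> /arc_flow_lines[[s [b1 [b2 [sab o1 o2]]]]|[p /singular_not_figure pM cst]] tab t'ab.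
  have to_s z : a <= z <= b -> figure_eight (gam z) <-> figure_eight (gam s).
    move=> zab; have [zs|sz] := leP z s.
      by split; apply: (side _ _ _ _ _ o1); lra.
    by split; apply: (side _ _ _ _ _ o2); lra.
  by rewrite (to_s t) // (to_s t').
by rewrite cst.
Qed.
End Orbits.

(** * Passing from arcs to whole trajectories *)

Section Chains.
Variable R : realType.
Implicit Types (Q : R -> R -> Prop) (x y z : R).

(** Any property of pairs of times that is reflexive and composes passes from the arcs to their
    concatenation; invariance, advance of the phase, constancy of the sign during a turn and
    Lipschitz bounds are all put in this form. *)
Lemma chain_relation Q (t : nat -> R) n :
  (forall x, Q x x) -> (forall y x z, x <= y -> y <= z -> Q x y -> Q y z -> Q x z) ->
  (forall i x y, (i < n)%N -> t i <= x -> x <= y -> y <= t i.+1 -> Q x y) ->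
  forall x y, t 0%N <= x -> x <= y -> y <= t n -> Q x y.
Proof.
move=> Qxx Qtr; elim: n => [|n IH] Qarc x y tx xy yt.
  by rewrite (_ : y = x) //; apply/le_anti; rewrite xy (le_trans yt tx).
have {}IH : forall x y, t 0%N <= x -> x <= y -> y <= t n -> Q x y.
  by apply: IH => i z w iN; apply: Qarc; exact: ltnW.
have [ytn|tny] := leP y (t n); first exact: IH.
have [tnx|xtn] := leP (t n) x; first exact: (Qarc n).
by apply: (Qtr (t n)); [exact: ltW|exact: ltW|apply: IH => //; exact: ltW|
  apply: (Qarc n) => //; exact: ltW].
Qed.

(** Since the cutting times tend to both infinities, finitely many arcs cover [[x, y]]. *)
Lemma global_chain r (Z : nsvf R r) gam Q : global_trajectory Z gam ->
  (forall x, Q x x) -> (forall y x z, x <= y -> y <= z -> Q x y -> Q y z -> Q x z) ->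
  (forall a b x y, Defs.arc Z a b gam -> a <= x -> x <= y -> y <= b -> Q x y) ->
  forall x y, x <= y -> Q x y.
Proof.
move=> [t [arct tpy tny]] Qxx Qtr Qarc x y xy.
have [n ytn] : exists n : nat, y <= t n%:Z.
  by move/cvgryPge : tpy => /(_ y) [N _ /(_ N (leqnn N))]; exists N.
have [m tmx] : exists m : nat, t (- m%:Z) <= x.
  by move/cvgrNyPle : tny => /(_ x) [N _ /(_ N (leqnn N))]; exists N.
apply: (@chain_relation Q (fun i => t (i%:Z - m%:Z)) (n + m) Qxx Qtr) => //.
- move=> i x' y' _; apply: Qarc.
  have [_] := arct (i%:Z - m%:Z).
  by rewrite (_ : i.+1%:Z - m%:Z = i%:Z - m%:Z + 1) // -addn1 PoszD addrAC.
- by rewrite sub0r.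
- by rewrite PoszD addrK.
Qed.

End Chains.

(** * Invariance of the figure eight, and its phase *)

Section Phase.
Variables (R : realType) (c : R) (r : nat).
Hypothesis c0 : 0 < c.
Implicit Types (p q v : plane R) (gam : R -> plane R) (J : set R).
Let Z := lens c r.
Local Notation P := (profile R).

Lemma figure_eight_invariant : Z_invariant Z (@figure_eight R).
Proof.
move=> I gam [[itvI _ ch] _] [t It Mt] t' It'.
have key a b : I a -> I b -> a < b ->
    figure_eight (gam a) <-> figure_eight (gam b).
  move=> Ia Ib ab; have [n [tt [<- <- arcs]]] := ch _ _ Ia Ib ab.
  have tn : tt 0%N <= tt n.
    have mono i : (i <= n)%N -> tt 0%N <= tt i.
      by elim: i => // i IH iN; rewrite (le_trans (IH (ltnW iN))) // ltW // (arcs _ iN).1.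
    exact: mono.
  apply: (@chain_relation R (fun x y => figure_eight (gam x) <-> figure_eight (gam y)) tt n) => //.
    by move=> y x z _ _ -> ->.
  move=> i x y iN tx xy yt; have [_ ai] := arcs _ iN.
  by split; apply: (arc_figure c0 ai); lra.
have [tt'|tt'|<-//] := ltgtP t t'; first exact/(key t t').
exact/(key t' t).
Qed.

Lemma profile_ge0 x : x ^+ 2 <= 1 -> 0 <= P.[x].
Proof. by move=> x1; rewrite profileE mulr_ge0 ?sqr_ge0 ?subr_ge0. Qed.

Lemma profile_eq0 x : P.[x] = 0 -> [\/ x = 0, x = 1 | x = -1].
Proof.
rewrite profileE => /eqP; rewrite mulf_eq0 sqrf_eq0 subr_eq0 (eq_sym 1) sqrf_eq1.
by case/or3P => /eqP ->; [apply: Or31|apply: Or32|apply: Or33].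
Qed.

(* The phase of a point of the figure eight is a real number modulo 2: the
   abscissa on the upper arcs, and its opposite on the lower ones. *)
Definition phase (u : R) p := exists b (k : int),
  [/\ p 0 0 ^+ 2 <= 1, p 0 1 = orient R b * P.[p 0 0]
    & u = orient R b * p 0 0 + 2 * k%:~R].

Lemma phase_figure u p : phase u p -> figure_eight p.
Proof.
case=> b [k [x1 y _]]; split=> //; rewrite y.
by rewrite /orient; case: b {y}; ring.
Qed.

Lemma figure_phase p : figure_eight p -> exists u, phase u p.
Proof.
move=> [x1 /eqP]; rewrite eqf_sqr => /orP[] /eqP y.
  by exists (p 0 0), true, 0; rewrite y /orient !mul1r mulr0 addr0.
by exists (- p 0 0), false, 0; rewrite y /orient !mulN1r mulr0 addr0.
Qed.

Lemma phase_shift u p (j : int) : phase u p -> phase (u + 2 * j%:~R) p.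
Proof.
case=> b [k [x1 y ->]]; exists b, (k + j); split=> //.
rewrite intrD; ring.
Qed.

(** A point seen from both sides has [P = 0]. There the abscissa and its opposite agree modulo [2],
    being [0] at the node and differing by [2] at the tips; this is why the phase is taken modulo
    [2]. *)
Lemma phase_side b u p : 0 <= orient R b * p 0 1 -> phase u p ->
  exists k : int, u = orient R b * p 0 0 + 2 * k%:~R.
Proof.
move=> y0 [b' [k [x1 y ->]]].
have [->|bb'] := eqVneq b b'; first by exists k.
have e : orient R b' = - orient R b.
  by move: bb'; rewrite /orient; case: b {y0}; case: b' {y} => // _; rewrite opprK.
have e1 : orient R b * orient R b = 1 by rewrite /orient; case: (b); ring.
have P0 := profile_ge0 x1.
have /profile_eq0 : P.[p 0 0] = 0.
  by move: y0; rewrite y e mulrA mulrN e1 mulN1r => ?; lra.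
rewrite e; case=> ->.
- by exists k; rewrite !mulr0.
- case: b {y0 bb' e e1}; [exists (k - 1)|exists (k + 1)];
    rewrite ?intrB ?intrD /orient; ring.
- case: b {y0 bb' e e1}; [exists (k + 1)|exists (k - 1)];
    rewrite ?intrB ?intrD /orient; ring.
Qed.

Lemma flow_line_phase b J gam u t t' : flow_line c b J gam -> J t -> J t' ->
  phase u (gam t) -> phase (u + c * (t' - t)) (gam t').
Proof.
move=> orb Jt Jt' ph; have [x H y0] := orb _ _ Jt Jt'.
have [_ _ y0'] := orb _ _ Jt' Jt.
have M := phase_figure ph; have M' := flow_line_figure orb Jt Jt' M.
have [k ->] := phase_side y0 ph.
have [x1' _] := M'; move: M' => /(figure_side y0') y'.
exists b, k; split=> //.
have -> : c * (t' - t) = orient R b * (gam t' 0 0 - gam t 0 0).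
  by rewrite x /orient; case: (b); ring.
ring.
Qed.

Lemma arc_phase a b gam u t t' : Defs.arc Z a b gam -> a <= t <= b -> a <= t' <= b ->
  phase u (gam t) -> phase (u + c * (t' - t)) (gam t').
Proof.
have side b' x y z z' u' : flow_line c b' `[x, y] gam -> x <= z <= y -> x <= z' <= y ->
    phase u' (gam z) -> phase (u' + c * (z' - z)) (gam z').
  by move=> orb zxy z'xy; apply: (flow_line_phase orb); rewrite /= in_itv.
move=> /arc_flow_lines[[s [b1 [b2 [sab o1 o2]]]]|[p /(singular_not_figure c0) pM cst]]
  tab t'ab ph; last first.
  by case: pM; rewrite -(cst t) //; exact: phase_figure ph.
have phs : phase (u + c * (s - t)) (gam s).
  by have [ts|st] := leP t s;
    [apply: (side _ _ _ _ _ _ o1)|apply: (side _ _ _ _ _ _ o2)] => //; lra.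
rewrite (_ : u + c * (t' - t) = u + c * (s - t) + c * (t' - s)); last by ring.
by have [ts|st] := leP t' s;
  [apply: (side _ _ _ _ _ _ o1)|apply: (side _ _ _ _ _ _ o2)] => //; lra.
Qed.

End Phase.

(** * Every trajectory on the figure eight is an itinerary *)

Section Coding.
Variables (R : realType) (c : R) (r : nat).
Hypothesis c0 : 0 < c.
Implicit Types (p q v : plane R) (gam : R -> plane R) (J : set R) (s : int -> bool).
Let Z := lens c r.
Local Notation P := (profile R).

Definition upper (x : R) : plane R := vec x P.[x].

(* One turn around the right loop, for [0 <= x <= 2]. *)
Definition loop (x : R) : plane R := if x <= 1 then upper x else - upper (x - 2).

(* The sign sequence [s] records the side of the successive turns. *)
Definition itinerary s (u : R) : plane R :=
  let k := Num.floor (u / 2) in orient R (s k) *: loop (u - 2 * k%:~R).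

Lemma upper0 : upper 0 = 0.
Proof. by apply: plane_eqP; rewrite vecE ?mxE // profileE expr0n mul0r. Qed.

Lemma loop0 : loop 0 = 0. Proof. by rewrite /loop ler01 upper0. Qed.

Lemma loop2 : loop 2 = 0.
Proof. by rewrite /loop ifF ?subrr ?upper0 ?oppr0 //; apply/negbTE; rewrite -ltNge; lra. Qed.

Lemma upper1 : upper 1 = - upper (-1).
Proof.
apply: plane_eqP; rewrite ?mxE ?vecE /=; first by rewrite opprK.
by rewrite !profileE; ring.
Qed.

Lemma upper_coord b p x : p 0 0 = orient R b * x -> p 0 1 = orient R b * P.[x] ->
  p = orient R b *: upper x.
Proof. by move=> p0 p1; apply: plane_eqP; rewrite [RHS]mxE vecE. Qed.

Lemma orientN b : orient R (~~ b) = - orient R b.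
Proof. by case: b; rewrite /orient ?opprK. Qed.

Lemma profile_orient b x : P.[orient R b * x] = P.[x].
Proof. by rewrite /orient; case: b; rewrite ?mul1r // mulN1r profileN. Qed.

Lemma phase_loop u p (k : int) : phase u p -> 2 * k%:~R <= u -> u <= 2 * (k + 1)%:~R ->
  exists b, p = orient R b *: loop (u - 2 * k%:~R).
Proof.
case=> b [j [x1 y uE]]; rewrite intrD => ku uk.
have pE : p = orient R b *: upper (orient R b * p 0 0).
  apply: upper_coord; last by rewrite profile_orient.
  by rewrite /orient; case: (b); ring.
set w := orient R b * p 0 0 in uE pE.
have w1 : w ^+ 2 <= 1 by rewrite /w exprMn /orient; case: (b); rewrite ?sqrrN expr1n mul1r.
have wge : -1 <= w by nra.
have wle : w <= 1 by nra.
(* The phase is [w + 2 j] with [w] in [[-1, 1]]: [j = k] in the first half of the turn, [j = k + 1]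
   in the second, where the side is reversed. *)
have [kj jk] : k <= j /\ j <= k + 1.
  have jk1 : j%:~R - k%:~R <= 3 / 2 :> R by lra.
  have jk2 : - (1 / 2) <= j%:~R - k%:~R :> R by lra.
  split; rewrite -ltzD1 -(ltr_int R) !intrD; lra.
move: jk; rewrite le_eqVlt ltzD1 => /orP[/eqP jE|jk].
  exists (~~ b); rewrite {}pE orientN scaleNr -scalerN; congr (_ *: _).
  move: uE; rewrite jE intrD => uE; rewrite /loop.
  have [wE|wN] := eqVneq w (-1).
    rewrite (_ : u - _ = 1); last by lra.
    by rewrite lexx upper1 opprK wE.
  rewrite ifF; first by rewrite opprK; congr upper; lra.
  apply/negbTE; rewrite -ltNge.
  have : -1 < w by rewrite lt_neqAle eq_sym wN.
  lra.
have {kj jk} jE : j = k by apply/le_anti; rewrite kj jk.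
exists b; rewrite {}pE; congr (_ *: _); move: uE; rewrite jE /loop => uE.
by rewrite ifT; [congr upper|]; lra.
Qed.

(** A turn keeps its sign once the node is left, whence the strict [0 < x]. If the flow is not the
    one of the half-loop where [gam t] lies, then [P] vanishes at [gam t]: either [x = 2] and no
    time passes, or [x = 1] and the motion goes on along the second half. *)
Lemma flow_line_loop b b' J gam t t' (x : R) : flow_line c b J gam -> J t -> J t' -> t <= t' ->
  0 < x -> x + c * (t' - t) <= 2 -> gam t = orient R b' *: loop x ->
  figure_eight (gam t) -> gam t' = orient R b' *: loop (x + c * (t' - t)).
Proof.
move=> orb Jt Jt' tt' x0 x2 gt M; have [xx' _ y0] := orb _ _ Jt Jt'.
have [_ _ y0'] := orb _ _ Jt' Jt.
have [x1' _] := flow_line_figure orb Jt Jt' M.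
have y' := (figure_side y0').1 (flow_line_figure orb Jt Jt' M).
have y := (figure_side y0).1 M.
have d0 : 0 <= c * (t' - t) by rewrite mulr_ge0 ?subr_ge0 // ltW.
move: xx' x2 d0; set d := c * (t' - t) => xx' x2 d0.
have {}xx' : gam t' 0 0 = gam t 0 0 + orient R b * d by lra.
have upperP b1 w : b = b1 -> gam t' 0 0 = orient R b1 * w -> gam t' = orient R b1 *: upper w.
  by move=> bb1 w0; apply: upper_coord => //; rewrite y' w0 profile_orient bb1.
have sq1 b1 w : gam t' 0 0 = orient R b1 * w -> w <= 1.
  by move=> w0; move: x1'; rewrite w0 exprMn /orient; case: (b1); rewrite ?sqrrN expr1n mul1r; nra.
have [bb'|bb'] := eqVneq b b'; last have {bb'} bN : b = ~~ b' by move: bb'; case: (b); case: (b').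
- rewrite -bb' in gt *; move: gt; rewrite {1}/loop; case: ifP => [x1|/negbT].
    move=> gt; have x't : gam t' 0 0 = orient R b * (x + d).
      by rewrite xx' gt mxE vecE; ring.
    by rewrite /loop (sq1 _ _ x't); exact: upperP.
  rewrite -ltNge => x1 gt.
  have /profile_eq0 : P.[x - 2] = 0.
    move: y; rewrite gt !mxE /=.
    by rewrite profile_orient profileN /orient; case: (b) => ?; lra.
  case=> x20; [|exfalso; lra|exfalso; lra].
  have -> : x + d = 2 by lra.
  rewrite loop2 scaler0; apply: plane_eqP; rewrite mxE.
    by rewrite xx' gt !mxE /= x20; have -> : d = 0 by [lra]; ring.
  rewrite y' xx' gt !mxE /= x20; have -> : d = 0 by lra.
  by rewrite !mulr0 oppr0 mulr0 addr0 profileE; ring.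
- move: gt; rewrite {1}/loop; case: ifP => [x1|/negbT].
    move=> gt; have /profile_eq0 : P.[x] = 0.
      move: y; rewrite gt !mxE /= profile_orient bN orientN /orient.
      by case: (b') => ?; lra.
    case=> [?|xE|?]; [exfalso; lra| |exfalso; lra].
    have g' : gam t' 0 0 = orient R b * (x + d - 2).
      by rewrite xx' gt mxE vecE bN orientN xE; ring.
    rewrite (upperP _ _ erefl g') bN orientN scaleNr /loop; case: ifP => [xd|_].
      have -> : x + d = 1 by lra.
      by rewrite (_ : 1 - 2 = -1) ?upper1 ?scalerN //; lra.
    by rewrite scalerN.
  rewrite -ltNge => x1 gt.
  have g' : gam t' 0 0 = orient R b * (x + d - 2).
    by rewrite xx' gt !mxE /= bN orientN; ring.
  rewrite (upperP _ _ erefl g') bN orientN scaleNr /loop ifF ?scalerN //.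
  by apply/negbTE; rewrite -ltNge; lra.
Qed.

Lemma arc_loop a b b' gam t t' (x : R) : Defs.arc Z a b gam ->
  a <= t -> t <= t' -> t' <= b -> 0 < x -> x + c * (t' - t) <= 2 ->
  figure_eight (gam t) ->
  gam t = orient R b' *: loop x -> gam t' = orient R b' *: loop (x + c * (t' - t)).
Proof.
move=> /arc_flow_lines[[s [b1 [b2 [/andP[asl slb] o1 o2]]]]|[p /(singular_not_figure c0) pM cst]]
  aT tt' t'b x0 x2 M gt; last by case: pM; rewrite -(cst t) //; lra.
have [t's|st'] := leP t' s.
  by apply: (flow_line_loop o1) => //; rewrite /= in_itv /=; lra.
have [st|ts] := leP s t.
  by apply: (flow_line_loop o2) => //; rewrite /= in_itv /=; lra.
have cs : 0 <= c * (s - t) by rewrite mulr_ge0 ?subr_ge0 ?ltW.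
have ct : 0 <= c * (t' - s) by rewrite mulr_ge0 ?subr_ge0 ?ltW.
have E : x + c * (t' - t) = x + c * (s - t) + c * (t' - s) by ring.
have Js : `[a, s]%classic s by rewrite /= in_itv /=; lra.
have Js' : `[s, b]%classic s by rewrite /= in_itv /=; lra.
have Jt : `[a, s]%classic t by rewrite /= in_itv /=; lra.
have Jt' : `[s, b]%classic t' by rewrite /= in_itv /=; lra.
have gs : gam s = orient R b' *: loop (x + c * (s - t)).
  by apply: (flow_line_loop o1 Jt Js) => //; [exact: ltW|lra].
rewrite E; apply: (flow_line_loop o2 Js' Jt') => //.
- exact: ltW.
- lra.
- by rewrite -E.
- exact: flow_line_figure o1 Jt Js M.
Qed.

(** Both ends of a turn are allowed because [loop] vanishes at [0] and at [2], so the next sign is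
    immaterial at the junction. *)
Lemma itineraryE s (k : int) (u : R) : 2 * k%:~R <= u -> u <= 2 * (k + 1)%:~R ->
  itinerary s u = orient R (s k) *: loop (u - 2 * k%:~R).
Proof.
move=> ku; rewrite le_eqVlt => /orP[/eqP ->|uk].
  rewrite /itinerary mulrAC mulfV ?mul1r ?pnatr_eq0 // floorK ?intr_int //.
  rewrite subrr loop0 scaler0 intrD.
  by rewrite (_ : _ - _ = 2) ?loop2 ?scaler0 //; ring.
rewrite /itinerary (_ : Num.floor (u / 2) = k) //.
apply: floor_def; rewrite ler_pdivlMr // ltr_pdivrMr // ![_ * 2]mulrC.
by rewrite ku uk.
Qed.

Lemma floor_half (u : R) : let k := Num.floor (u / 2) in
  2 * k%:~R <= u /\ u < 2 * (k + 1)%:~R.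
Proof.
move=> k; have /andP[] := floor_itv (u / 2).
by rewrite ler_pdivlMr // ltr_pdivrMr // ![_ * 2]mulrC.
Qed.

Lemma Omega_itinerary gam : Omega Z (@figure_eight R) gam ->
  exists (b : R) s, 0 <= b < 2 /\ gam = fun t => itinerary s (c * t + b).
Proof.
move=> [glob M].
have [u0 ph0] := figure_phase (M 0).
pose b := u0 - 2 * (Num.floor (u0 / 2))%:~R.
have phb : phase b (gam 0).
  have := phase_shift (- Num.floor (u0 / 2)) ph0.
  by rewrite mulrNz mulrN.
have b02 : 0 <= b < 2.
  by have [] := floor_half u0; rewrite intrD /b => ? ?; lra.
have ph t : phase (c * t + b) (gam t).
  (* An equivalence, because chains only run forward while the phase known at time [0] is also
     needed at negative times. *)
  have key := @global_chain _ _ _ gam (fun t t' => forall u, phase u (gam t) <->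
    phase (u + c * (t' - t)) (gam t')) glob.
  have {}key : forall t t', t <= t' -> forall u, phase u (gam t) <->
      phase (u + c * (t' - t)) (gam t').
    apply: key.
    - by move=> x u; rewrite subrr mulr0 addr0.
    - move=> y x z _ _ xy yz u; rewrite xy yz.
      by rewrite (_ : u + _ + _ = u + c * (z - x)) //; ring.
    - move=> d e x y ar dx xy ye u; split; first by apply: (arc_phase c0 ar); lra.
      move/(arc_phase c0 ar (_ : d <= y <= e) (_ : d <= x <= e)).
      rewrite (_ : u + _ + _ = u); last by ring.
      by apply; lra.
  have [t0|t0] := leP 0 t.
    by rewrite addrC; have := (key 0 t t0 b).1 phb; rewrite subr0.
  apply/(key _ _ (ltW t0)).
  by rewrite (_ : _ + _ = b) //; ring.
(* The time of phase [2 k + 1], when turn [k] is at its tip: the two loops are farthest apart there,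
   and the sign is read off the abscissa. *)
pose mid (k : int) : R := (2 * k%:~R + 1 - b) / c.
have midE k : c * mid k + b = 2 * k%:~R + 1.
  by rewrite /mid mulrC divfK ?subrK // gt_eqF.
have /choice[s sP] (k : int) : exists d, gam (mid k) = orient R d *: loop 1.
  have := ph (mid k); rewrite midE => /phase_loop.
  move=> /(_ k); rewrite intrD addrAC subrr add0r; apply; lra.
exists b, s; split=> //; apply/funext => t.
set u := c * t + b; have [] := floor_half u; set k := Num.floor (u / 2) => ku uk.
rewrite (@itineraryE _ k) //; last exact: ltW.
move: uk; rewrite intrD => uk.
have [d dP] : exists d, gam t = orient R d *: loop (u - 2 * k%:~R).
  by apply: phase_loop; [exact: ph|exact: ku|rewrite intrD; exact: ltW].
have [ku2|ku'] := eqVneq (2 * k%:~R) u.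
  by rewrite dP -ku2 subrr loop0 !scaler0.
have {ku' ku} ku : 2 * k%:~R < u by rewrite lt_neqAle ku' ku.
have turn : forall t t', t <= t' -> forall (x : R) d, 0 < x -> x + c * (t' - t) <= 2 ->
    gam t = orient R d *: loop x -> gam t' = orient R d *: loop (x + c * (t' - t)).
  apply: (global_chain glob).
  - by move=> y w e _ _; rewrite subrr mulr0 addr0.
  - move=> y x z xy yz Qxy Qyz w e w0 w2 gx.
    have d1 : 0 <= c * (y - x) by rewrite mulr_ge0 ?subr_ge0 // ltW.
    have d2 : 0 <= c * (z - y) by rewrite mulr_ge0 ?subr_ge0 // ltW.
    have E : w + c * (z - x) = w + c * (y - x) + c * (z - y) by ring.
    by rewrite E; apply: Qyz; [lra|rewrite -E|apply: Qxy => //; lra].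
  - by move=> m n x y ar mx xy yn w e w0 w2; apply: (arc_loop ar).
have midk : c * (t - mid k) = u - 2 * k%:~R - 1.
  by have := midE k; rewrite /u mulrBr; lra.
have [mt|tm] := leP (mid k) t.
  have := turn _ _ mt 1 (s k) ltr01; rewrite midk.
  by rewrite (_ : 1 + _ = u - 2 * k%:~R); [apply; [lra|exact: sP]|ring].
(* Before the tip, the sign [d] found at time [t] is carried forward to [mid k] and compared with
   [s k] there. *)
have midk' : c * (mid k - t) = 1 - (u - 2 * k%:~R) by rewrite -opprB mulrN midk; ring.
have := turn _ _ (ltW tm) (u - 2 * k%:~R) d; rewrite midk'.
rewrite (_ : _ + (1 - _) = 1); last by ring.
move=> /(_ _ _ dP); rewrite sP dP => h.
suff -> : s k = d by [].
have {h} : orient R (s k) *: loop 1 = orient R d *: loop 1 by apply: h; lra.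
rewrite /loop lexx => /(congr1 (fun v : plane R => v 0 0)); rewrite !mxE /= !mulr1 /orient.
by case: (s k); case: (d) => //; lra.
Qed.

End Coding.

(** * Every itinerary is a trajectory *)

Section Realization.
Variables (R : realType) (c : R) (r : nat).
Hypothesis c0 : 0 < c.
Implicit Types (p q v : plane R) (gam : R -> plane R) (J : set R) (s : int -> bool).
Let Z := lens c r.
Local Notation P := (profile R).

Lemma is_derive_vec (f g : R -> R) (t df dg : R) : is_derive t 1 f df ->
  is_derive t 1 g dg -> is_derive t 1 (fun u => vec (f u) (g u)) (vec df dg).
Proof.
move=> [dvf <-] [dvg <-].
have E i j : (fun u => vec (f u) (g u) i j) = if j == 0 then f else g.
  by apply/funext => u; rewrite mxE; case: ifP.
have dv : derivable (fun u => vec (f u) (g u)) t 1.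
  by apply/derivable_mxP => i j; rewrite E; case: ifP.
apply: DeriveDef => //; rewrite derive_mx //.
by apply/matrixP => i j; rewrite !mxE E; case: ifP.
Qed.

Lemma deriv_profile_orient b x : P^`().[orient R b * x] = orient R b * P^`().[x].
Proof.
by rewrite /profile /orient !(derivB, derivXn, hornerE) /=; case: b; ring.
Qed.

Lemma is_derive_upper b (t : R) : is_derive t 1 (fun u => orient R b *: upper (c * u))
  ((if b then lens_X c else lens_Y c) (orient R b *: upper (c * t))).
Proof.
have dl : is_derive t 1 (fun u => c * u) c.
  by apply: is_derive_eq; rewrite /GRing.scale /= mulr1.
have dP := @is_derive1_comp _ (horner P) (fun u => c * u) t _ _ (is_derive_poly P _) dl.
have := is_derive_vec (is_deriveZ (orient R b) dl) (is_deriveZ (orient R b) dP).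
rewrite (_ : (fun u => vec _ _) = fun u => orient R b *: upper (c * u)); last first.
  by apply/funext => u; apply: plane_eqP; rewrite [RHS]mxE !vecE.
congr is_derive; apply: plane_eqP; rewrite [LHS]vecE /GRing.scale /=.
  by rewrite /orient; case: (b); rewrite vecE ?mul1r ?mulN1r.
transitivity (c * P^`().[orient R b * (c * t)]).
  by rewrite deriv_profile_orient; ring.
by case: (b); rewrite vecE mxE vecE.
Qed.

Lemma follows_upper b J gam : (forall u, J u -> gam u = orient R b *: upper (c * u)) ->
  (forall u, J u -> -1 <= c * u <= 1) -> follows Z (flow b) J gam.
Proof.
move=> gE J1; split.
- move=> t Jt; apply/lens_region; rewrite gE // mxE vecE.
  have /andP[l1 l2] := J1 t Jt; have : 0 <= P.[c * t] by apply: profile_ge0; nra.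
  by rewrite /orient; case: (b) => ?; lra.
- apply: (@subspace_eq_continuous _ _ _ (fun u => orient R b *: upper (c * u))).
    by move=> u; rewrite inE => /gE.
  apply: continuous_subspaceT => u.
  by apply/differentiable_continuous/derivable1_diffP; case: (is_derive_upper b u).
- move=> t Jt; exists ((if b then lens_X c else lens_Y c) (gam t)).
    by case: (b).
  rewrite (gE t); last exact: interior_subset.
  apply: near_eq_is_derive (is_derive_upper b t).
  by apply: filterS Jt => u /gE.
Qed.

Lemma node_regular : regular_tangency Z (0 : plane R).
Proof.
split.
  split; first by split=> //=; rewrite /lens_height mxE.
  by rewrite lens_Xf lens_Yf hornerZ mxE !(derivB, derivXn, hornerE) /=; ring.
case=> _ [_]; rewrite lens_X2f mxE /profile !(derivB, derivXn, derivMn, hornerE) /= => + _.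
by nra.
Qed.

Lemma itinerary_node s (i : int) : itinerary s (2 * i%:~R : R) = 0.
Proof.
rewrite (@itineraryE _ _ i) ?intrD; [|lra..].
by rewrite subrr loop0 scaler0.
Qed.

Lemma itinerary_after s (i : int) (v : R) : 0 <= v <= 1 ->
  itinerary s (2 * i%:~R + v) = orient R (s i) *: upper v.
Proof.
move=> /andP[v0 v1]; rewrite (@itineraryE _ _ i) ?intrD; [|lra..].
by rewrite addrAC subrr add0r /loop v1.
Qed.

(** The second half of a right turn lies below the axis, and that of a left turn above: hence the
    negated sign of the previous turn. *)
Lemma itinerary_before s (i : int) (v : R) : -1 <= v <= 0 ->
  itinerary s (2 * i%:~R + v) = orient R (~~ s (i - 1)) *: upper v.
Proof.
move=> /andP[v0 v1]; rewrite (@itineraryE _ _ (i - 1)) ?subrK ?intrB; [|lra..].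
rewrite orientN scaleNr -scalerN; congr (_ *: _).
rewrite (_ : _ - _ = v + 2); last by ring.
rewrite /loop; case: ifP => v2; last by rewrite addrK.
by rewrite (_ : v = -1) ?[X in upper X](_ : _ = 1) ?upper1 //; lra.
Qed.

Lemma upper_in_figure b (v : R) : -1 <= v <= 1 -> figure_eight (orient R b *: upper v).
Proof.
move=> /andP[v1 v2]; rewrite /figure_eight /= !mxE /= profile_orient /orient.
by case: b; split; rewrite ?mul1r ?mulN1r ?sqrrN //; nra.
Qed.

Lemma itinerary_in_figure s (u : R) : figure_eight (itinerary s u).
Proof.
have [ku] := floor_half u; set k := Num.floor (u / 2) in ku * => uk.
have [u1|u1] := leP (u - 2 * k%:~R) 1.
  rewrite -[u](subrKC (2 * k%:~R)) itinerary_after; first by apply: upper_in_figure; lra.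
  lra.
rewrite intrD in uk.
rewrite -[u](subrKC (2 * (k + 1)%:~R)) itinerary_before.
  by apply: upper_in_figure; rewrite intrD; lra.
rewrite intrD; lra.
Qed.

(** The curve is cut at the tips, so that every arc is based at the node. Being a regular tangency,
    the node allows any flow before it and any flow after it. *)
Lemma itinerary_Omega s (b : R) :
  Omega Z (@figure_eight R) (fun t => itinerary s (c * t + b)).
Proof.
split; last by move=> t; exact: itinerary_in_figure.
exists (fun i => (2 * i%:~R - 1 - b) / c); split.
- move=> i; split; first by rewrite ltr_pM2r ?invr_gt0 // intrD; lra.
  set m := (2 * i%:~R - b) / c.
  have mE u : c * (m + u) + b = 2 * i%:~R + c * u.
    by rewrite mulrDr /m mulrC divfK ?gt_eqF //; ring.
  have l : (2 * i%:~R - 1 - b) / c - m = - (1 / c).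
    by rewrite /m -mulrBl -mulNr; congr (_ / _); ring.
  have u : (2 * (i + 1)%:~R - 1 - b) / c - m = 1 / c.
    by rewrite /m -mulrBl intrD; congr (_ / _); ring.
  have ic : 0 < 1 / c by rewrite divr_gt0.
  exists m; first by apply/andP; split; lra.
  rewrite l u; split.
  + by move=> x y /= + + z; rewrite !in_itv /=; lra.
  + by rewrite /= in_itv /=; lra.
  + by rewrite addr0.
  have J1 u' : - (1 / c) <= u' <= 1 / c -> -1 <= c * u' <= 1.
    move=> /andP[u1 u2]; apply/andP; split.
      by rewrite mulrC -ler_pdivrMr // mulNr.
    by rewrite mulrC -ler_pdivlMr.
  apply: (@law_regular _ _ _ _ _ _ (flow (~~ s (i - 1))) (flow (s i))).
  + rewrite (_ : itinerary _ _ = 0); first exact: node_regular.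
    by have := mE 0; rewrite addr0 mulr0 addr0 => ->; exact: itinerary_node.
  + apply: follows_upper => t [/= + t0]; rewrite in_itv /= => /J1/andP[t1 t2]; last lra.
    by rewrite mE itinerary_before // t1 pmulr_rle0.
  + apply: follows_upper => t [/= + t0]; rewrite in_itv /= => /J1/andP[t1 t2]; last lra.
    by rewrite mE itinerary_after // t2 pmulr_rge0 // t0.
- apply/cvgryPge => A; near=> n.
  rewrite ler_pdivlMr // -pmulrn.
  suff : (A * c + 1 + b) / 2 <= n%:R by lra.
  by near: n; exact: nbhs_infty_ger.
- apply/cvgrNyPle => A; near=> n.
  rewrite ler_pdivrMr // intrN -pmulrn.
  suff : - (A * c + 1 + b) / 2 <= n%:R by lra.
  by near: n; exact: nbhs_infty_ger.
Unshelve. all: by end_near. Qed.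

End Realization.

(** * Estimates on [rho] *)

Section Rho.
Variable R : realType.
Local Open Scope ereal_scope.

Lemma nneseries_geometric_le (a : nat -> \bar R) (B : R) :
  (forall n, 0 <= a n) -> (forall n, a n <= (B * (2 / 3) ^+ n)%:E) ->
  \sum_(n <oo) a n <= (3 * B)%:E.
Proof.
move=> a0 aB; have B0 : (0 <= B)%R.
  by have := le_trans (a0 0%N) (aB 0%N); rewrite lee_fin expr0 mulr1.
apply: lime_le; first exact: is_cvg_nneseries.
apply: nearW => N.
(* The exact geometric partial sum makes the induction close. *)
have : \sum_(0 <= n < N) a n <= (3 * B * (1 - (2 / 3) ^+ N))%:E.
  elim: N => [|N IH]; first by rewrite big_nil expr0 subrr mulr0.
  rewrite big_nat_recr //= (le_trans (leeD IH (aB N))) // -EFinD lee_fin exprS.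
  lra.
move/le_trans; apply; rewrite lee_fin ler_piMr ?mulr_ge0 //.
Qed.

Lemma esum_int_geometric_le (a : int -> \bar R) (B : R) :
  (forall i, 0 <= a i) -> (forall i, a i <= (B * (2 / 3) ^+ `|i|%N)%:E) ->
  \esum_(i in [set: int]) a i <= (6 * B)%:E.
Proof.
move=> a0 aB; have B0 : (0 <= B)%R.
  by have := le_trans (a0 (Posz 0)) (aB (Posz 0)); rewrite lee_fin expr0 mulr1.
rewrite (esumID (range Posz)) // !setTI.
have -> : ~` range Posz = range Negz.
  apply/seteqP; split=> [[n|n]|_ [n _ <-]] /=.
  - by move=> /(_ _)[]; exists n.
  - by move=> _; exists n.
  - by case=> m _.
rewrite (@reindex_esum _ nat _ setT (range Posz) Posz); last first.
  by split=> [n _|x y _ _ []|_ [n _ <-]] //=; exists n.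
rewrite (@reindex_esum _ nat _ setT (range Negz) Negz); last first.
  by split=> [n _|x y _ _ []|_ [n _ <-]] //=; exists n.
rewrite -!nneseries_esumT //.
have -> : (6 * B)%:E = (3 * B)%:E + (3 * B)%:E by rewrite -EFinD; congr EFin; ring.
apply: leeD; apply: nneseries_geometric_le => // n.
(* The absolute value of [Negz n] is [n + 1], which costs one more factor [2 / 3]. *)
rewrite (le_trans (aB (Negz n))) // lee_fin ler_wpM2l //=.
rewrite exprS ler_piMl ?exprn_ge0 ?divr_ge0 //; lra.
Qed.

Lemma integral_itv_le (D : R -> R) (a b k : R) : (a <= b)%R -> continuous D ->
  (forall t, 0 <= D t)%R -> (forall t, a <= t <= b -> D t <= k)%R ->
  \int[lebesgue_measure]_(t in `[a, b]) (D t)%:E <= (k * (b - a))%:E.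
Proof.
move=> ab cD D0 Dk; have mD : measurable_fun `[a, b] (EFin \o D).
  by apply/measurable_EFinP/measurable_funTS; exact: continuous_measurable_fun.
apply: (@le_trans _ _ (\int[lebesgue_measure]_(t in `[a, b]) (cst k%:E t))).
  apply: ge0_le_integral => //.
  by move=> t; rewrite /= in_itv /= lee_fin => /Dk.
rewrite integral_cst //= lebesgue_measure_itv /= lte_fin.
by case: ltP => ab'; rewrite ?EFinM // (_ : b = a) ?subrr ?mulr0 ?mule0 //; lra.
Qed.

Lemma integral_itv_ge (D : R -> R) (a b a' b' k : R) : (a' <= b')%R -> continuous D ->
  (forall t, 0 <= D t)%R -> (a <= a')%R -> (b' <= b)%R ->
  (0 <= k)%R -> (forall t, a' <= t <= b' -> k <= D t)%R ->
  (k * (b' - a'))%:E <= \int[lebesgue_measure]_(t in `[a, b]) (D t)%:E.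
Proof.
move=> ab cD D0 aa' bb' k0 Dk.
have mD E : measurable_fun E (EFin \o D).
  by apply/measurable_EFinP/measurable_funTS; exact: continuous_measurable_fun.
apply: (@le_trans _ _ (\int[lebesgue_measure]_(t in `[a', b']) (D t)%:E)); last first.
  apply: ge0_subset_integral => //.
  - exact: mD.
  - by move=> t _; rewrite lee_fin.
  - by move=> t; rewrite /= !in_itv /=; lra.
apply: (@le_trans _ _ (\int[lebesgue_measure]_(t in `[a', b']) (cst k%:E t))).
  rewrite integral_cst //= lebesgue_measure_itv /= lte_fin.
  by case: ltP => ab'; rewrite ?EFinM // (_ : b' = a') ?subrr ?mulr0 ?mule0 //; lra.
apply: ge0_le_integral => //; exact: mD.
Qed.

Lemma integral_itvD (D1 D2 : R -> R) (a b : R) : continuous D1 -> continuous D2 ->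
  (forall t, 0 <= D1 t)%R -> (forall t, 0 <= D2 t)%R ->
  \int[lebesgue_measure]_(t in `[a, b]) (D1 t + D2 t)%:E =
  \int[lebesgue_measure]_(t in `[a, b]) (D1 t)%:E +
  \int[lebesgue_measure]_(t in `[a, b]) (D2 t)%:E.
Proof.
move=> c1 c2 D10 D20.
have mD (D : R -> R) : continuous D -> measurable_fun `[a, b] (EFin \o D).
  by move=> cD; apply/measurable_EFinP/measurable_funTS; exact: continuous_measurable_fun.
rewrite -ge0_integralD //; try exact: mD.
- by move=> t _; rewrite lee_fin.
- by move=> t _; rewrite lee_fin.
Qed.

Section Bounds.
Variables (g1 g2 : R -> plane R) (M : R).
Hypothesis dist_cont : continuous (fun t => dist (g1 t) (g2 t)).
Hypothesis dist_le : forall t, (dist (g1 t) (g2 t) <= M)%R.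

Local Notation mean i := (\int[lebesgue_measure]_(t in `[(i%:~R : R), (i + 1)%:~R])
  (dist (g1 t) (g2 t))%:E).
Local Notation term i := ((2 ^- `|i|%N)%:E * mean i).

Lemma rho_mean_ge0 (i : int) : 0 <= mean i.
Proof. by apply: integral_ge0 => t _; rewrite lee_fin dist_ge0. Qed.

Lemma rho_term_ge0 (i : int) : 0 <= term i.
Proof. by rewrite mule_ge0 ?rho_mean_ge0 // lee_fin invr_ge0 exprn_ge0. Qed.

Lemma rho_mean_le (i : int) (k : R) :
  (forall t, i%:~R <= t <= i%:~R + 1 -> dist (g1 t) (g2 t) <= k)%R -> mean i <= k%:E.
Proof.
move=> Dk; apply: le_trans (integral_itv_le (k := k) _ dist_cont _ _) _.
- by rewrite intrD; lra.
- by move=> t; exact: dist_ge0.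
- by move=> t; rewrite intrD; exact: Dk.
- by rewrite intrD lee_fin (_ : _ - _ = 1)%R ?mulr1 //; ring.
Qed.

(* Leaves a summable factor once the tail [n > K] has been made small. *)
Lemma half_pow_le (n K : nat) : (K < n)%N -> (2 ^- n <= (3 / 4) ^+ K * (2 / 3) ^+ n :> R)%R.
Proof.
move=> Kn; have -> : (2 ^- n = (3 / 4) ^+ n * (2 / 3) ^+ n :> R)%R.
  by rewrite -exprMn -exprVn; congr (_ ^+ _)%R; field.
rewrite ler_wpM2r ?exprn_ge0 ?divr_ge0 //.
by rewrite ler_wiXn2l ?divr_ge0 //; [lra|exact: ltnW].
Qed.

(** For [|i| <= K] the interval of integration lies in [[- K, K + 1]], where the distance is at most
    [d]; beyond, the bound [M] is paid with the small weight of the tail. *)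
Lemma rho_term_le (K : nat) (d : R) : (0 <= d)%R ->
  (forall t, - K%:R <= t <= K%:R + 1 -> dist (g1 t) (g2 t) <= d)%R ->
  forall i : int, term i <= ((d + M * (3 / 4) ^+ K) * (2 / 3) ^+ `|i|%N)%:E.
Proof.
move=> d0 Dd i; have M0 : (0 <= M)%R by rewrite (le_trans _ (dist_le 0)) ?dist_ge0.
have p0 : (0 <= 2 ^- `|i|%N :> R)%R by rewrite invr_ge0 exprn_ge0.
have [iK|Ki] := leqP `|i|%N K.
  have iK' : (`|i%:~R| <= K%:R :> R)%R by rewrite -intr_norm -abszE -pmulrn ler_nat.
  apply: (@le_trans _ _ ((2 ^- `|i|%N)%:E * d%:E)).
    rewrite lee_pmul // ?rho_mean_ge0 ?lee_fin //.
    apply: rho_mean_le => t it; apply: Dd.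
    by move: iK'; rewrite ler_norml; lra.
  rewrite -EFinM lee_fin mulrC ler_pM //.
    by rewrite lerDl mulr_ge0 // exprn_ge0 // divr_ge0.
  by rewrite -exprVn lerXn2r // ?nnegrE; lra.
apply: (@le_trans _ _ ((2 ^- `|i|%N)%:E * M%:E)).
  by rewrite lee_pmul // ?rho_mean_ge0 ?lee_fin //; exact: rho_mean_le.
rewrite -EFinM lee_fin.
apply: le_trans (_ : M * ((3 / 4) ^+ K * (2 / 3) ^+ `|i|%N) <= _)%R.
  by rewrite mulrC ler_wpM2l // half_pow_le.
by rewrite mulrA ler_wpM2r ?lerDr // exprn_ge0 // divr_ge0.
Qed.

Lemma rho_le (K : nat) (d : R) : (0 <= d)%R ->
  (forall t, - K%:R <= t <= K%:R + 1 -> dist (g1 t) (g2 t) <= d)%R ->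
  (rho g1 g2 <= 6 * (d + M * (3 / 4) ^+ K))%R.
Proof.
move=> d0 Dd; rewrite -lee_fin /rho.
have E := esum_int_geometric_le rho_term_ge0 (rho_term_le d0 Dd).
rewrite fineK // ge0_fin_numE; first exact: le_lt_trans E (ltry _).
by apply: esum_ge0 => i _; exact: rho_term_ge0.
Qed.

(** Since [fine] sends [+oo] to [0], a lower bound on [rho] requires the series to be finite, which
    follows from the bound [M]. *)
Lemma rho_ge_mean0 : mean (0 : int)%R <= (rho g1 g2)%:E.
Proof.
rewrite /rho fineK; last first.
  rewrite ge0_fin_numE; last by apply: esum_ge0 => i _; exact: rho_term_ge0.
  have M0 : (0 <= M)%R by rewrite (le_trans _ (dist_le 0)) ?dist_ge0.
  have := esum_int_geometric_le rho_term_ge0 (rho_term_le (K := 0%N) M0 (fun t _ => dist_le t)).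
  by move=> /le_lt_trans; apply; exact: ltry.
apply: esum_ge; exists [set (0 : int)%R].
  by split=> //; exact: finite_set1.
by rewrite fsbig_set1 expr0 invr1 mul1e.
Qed.

End Bounds.

(** With [g1 = g1'] as a common center, this turns pointwise separation of [g2] and [g2'] into
    separation for [rho]; the triangle inequality is then needed only in the plane. *)
Lemma rho_sum_ge (g1 g2 g1' g2' : R -> plane R) (M a b : R) :
  continuous (fun t => dist (g1 t) (g2 t)) -> continuous (fun t => dist (g1' t) (g2' t)) ->
  (forall t, dist (g1 t) (g2 t) <= M)%R -> (forall t, dist (g1' t) (g2' t) <= M)%R ->
  (0 <= a)%R -> (a <= b)%R -> (b <= 1)%R ->
  (forall t, a <= t <= b -> 1 <= dist (g1 t) (g2 t) + dist (g1' t) (g2' t))%R ->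
  (b - a <= rho g1 g2 + rho g1' g2')%R.
Proof.
move=> c1 c2 M1 M2 a0 ab b1 D1; rewrite -lee_fin.
have c12 : continuous (fun t => dist (g1 t) (g2 t) + dist (g1' t) (g2' t))%R.
  move=> t; apply: (@continuousD _ _ _ (fun t => dist (g1 t) (g2 t))).
    exact: c1.
  exact: c2.
have d0 t : (0 <= dist (g1 t) (g2 t) + dist (g1' t) (g2' t))%R.
  by rewrite addr_ge0 // dist_ge0.
have := integral_itv_ge ab c12 d0 a0 b1 ler01 D1; rewrite mul1r => /le_trans; apply.
rewrite integral_itvD //; [|by move=> t; exact: dist_ge0..].
rewrite EFinD; apply: leeD.
  exact: rho_ge_mean0 c1 M1.
exact: rho_ge_mean0 c2 M2.
Qed.

End Rho.

(** * Entropy *)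

Section Counting.
Variables (R : realType) (X : Type) (W : set X) (d : X -> X -> R) (g : X -> X).
Variables (eps : R) (n : nat) (T : finType) (f : T -> X).
Hypothesis fW : forall t, W (f t).

Lemma card_setT_finType : ([set: T] #= `I_#|T|)%card.
Proof.
rewrite (card_eqr card_II).
have -> : [set: T] = [set enum_val i | i in [set: 'I_#|T|]].
  by apply/seteqP; split=> // t _; exists (enum_rank t); rewrite ?enum_rankK.
by apply: inj_card_eq => i j _ _; exact: enum_val_inj.
Qed.

Lemma min_spanning_le :
  (forall y, W y -> exists t, bowen_dist d g n (f t) y < eps) ->
  (min_spanning W d g eps n <= (#|T|%:R)%:E)%E.
Proof.
move=> cover; have [k Ek] : finite_set (range f).
  by apply: finite_image; exact: finite_finset.
have kT : (k <= #|T|)%N.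
  rewrite -card_le_II -(card_le_eql Ek).
  by apply: card_le_trans (card_image_le _ _) _; rewrite (card_le_eql card_setT_finType).
apply: (@le_trans _ _ (k%:R)%:E); last by rewrite lee_fin ler_nat.
apply: ereal_inf_lbound; exists k => //; exists (range f) => //; split.
  by move=> _ [t _ <-].
by move=> y /cover[t]; exists (f t).
Qed.

(** Choosing for each [t] a center close to [f t] gives an injection into any spanning set. The
    centers range over [W], so separation is stated through an arbitrary third point. *)
Lemma min_spanning_ge :
  (forall x t t', W x -> bowen_dist d g n x (f t) < eps ->
    bowen_dist d g n x (f t') < eps -> t = t') ->
  ((#|T|%:R)%:E <= min_spanning W d g eps n)%E.
Proof.
move=> sep; apply: le_ereal_inf_tmp => _ [k [E Ek [EW cover]] <-].
rewrite lee_fin ler_nat -card_le_II -(card_le_eqr Ek).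
have /choice[h hP] t : exists x, E x /\ bowen_dist d g n x (f t) < eps.
  by have [x Ex xt] := cover _ (fW t); exists x.
have -> : (`I_#|T| #<= E)%card = (range h #<= E)%card.
  apply: card_le_eql; rewrite -(card_eql card_setT_finType).
  rewrite card_eq_sym; apply: inj_card_eq => t t' _ _ htt'.
  apply: (sep (h t)); [exact/EW/(hP t).1|exact: (hP t).2|].
  by rewrite htt'; exact: (hP t').2.
by apply: subset_card_le => _ [t _ <-]; exact: (hP t).1.
Qed.

End Counting.

Lemma bowen_dist_lt (R : realType) (X : Type) (d : X -> X -> R) (g : X -> X)
    (eps : R) n x y : 0 < eps ->
  bowen_dist d g n x y < eps <->
  forall i, (i < n)%N -> d (iter i g x) (iter i g y) < eps.
Proof.
move=> e0; split=> [/bigmax_ltP[_ h] i ilt|h]; first exact: (h (Ordinal ilt)).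
by apply: bigmax_lt => // i _; exact: h.
Qed.

(** * Lipschitz and size bounds for itineraries *)

Section ItineraryMetric.
Variable R : realType.
Local Notation P := (profile R).
Implicit Types (s : int -> bool) (u v x y t : R) (p q : plane R).

Lemma upper_lipschitz x y (j : 'I_2) : -1 <= x <= 1 -> -1 <= y <= 1 ->
  `|upper x 0 j - upper y 0 j| <= 2 * `|x - y|.
Proof.
move=> /andP[x1 x2] /andP[y1 y2].
have [->|j0] := eqVneq j 0.
  by rewrite !vecE -[leLHS]mul1r ler_wpM2r //; lra.
have -> : j = 1 by apply/val_inj; case: j j0 => -[|[]].
rewrite !vecE !profileE.
(* On [[-1, 1]] the first factor is at most [2] and the second at most [1] in absolute value. *)
rewrite (_ : _ - _ = (x + y) * (1 - x ^+ 2 - y ^+ 2) * (x - y)); last by ring.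
rewrite normrM ler_wpM2r // normrM -[leRHS]mulr1.
by rewrite ler_pM // ler_norml; nra.
Qed.

Lemma signed_upper_lipschitz b x y (j : 'I_2) : -1 <= x <= 1 -> -1 <= y <= 1 ->
  `|(orient R b *: upper x) 0 j - (orient R b *: upper y) 0 j| <= 2 * `|x - y|.
Proof.
move=> xI yI; rewrite ![(_ *: _ : plane R) 0 j]mxE -mulrBr normrM.
rewrite (_ : `|orient R b| = 1) ?mul1r; first exact: upper_lipschitz.
by rewrite /orient; case: b; rewrite ?normrN normr1.
Qed.

Lemma itinerary_lipschitz s (j : 'I_2) u v :
  `|itinerary s u 0 j - itinerary s v 0 j| <= 2 * `|u - v|.
Proof.
wlog uv : u v / u <= v.
  move=> H; have [|/ltW vu] := leP u v; first exact: H.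
  by rewrite distrC (distrC u); exact: H.
rewrite distrC (distrC u) (ger0_norm (_ : 0 <= v - u)) ?subr_ge0 //.
pose k := Num.floor (u / 2).
have [ku _] := floor_half u; rewrite -/k in ku.
have nv : v <= 2 * k%:~R + (Num.bound (v - 2 * k%:~R))%:R.
  by rewrite -lerBlDl ltW // archi_boundP // subr_ge0 (le_trans ku).
(* The phase axis is cut at the integers, into quarters of the eight between a node and a tip;
   parity tells whether the node comes first. *)
apply: (@chain_relation R (fun u v => `|itinerary s v 0 j - itinerary s u 0 j|
  <= 2 * (v - u)) (fun i => 2 * k%:~R + i%:R) _ _ _ _ u v _ uv nv).
- by move=> x; rewrite !subrr normr0 mulr0.
- move=> y x z xy yz Qxy Qyz; rewrite -(subrKA (itinerary s y 0 j)).
  by rewrite (le_trans (ler_normD _ _)) //; lra.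
- move=> i x y _ ix xy yi.
  rewrite -[y - x]ger0_norm ?subr_ge0 //.
  have [m [mE|mE]] : exists m : int, 2 * k%:~R + i%:R = 2 * m%:~R :> R \/
      2 * k%:~R + i%:R = 2 * m%:~R - 1 :> R.
    rewrite -(odd_double_half i); case: (odd i).
      exists (k + (i./2)%:Z + 1); right.
      by rewrite !intrD -pmulrn natrD -mul2n natrM mulr1z mulr1n; ring.
    exists (k + (i./2)%:Z); left.
    by rewrite !intrD -pmulrn natrD -mul2n natrM mulr0n; ring.
  + rewrite mE in ix; rewrite -[i.+1%:R]natr1 addrA mE in yi.
    rewrite -[x](subrKC (2 * m%:~R)) -[y](subrKC (2 * m%:~R)) !itinerary_after; [|lra..].
    rewrite !subrKC (_ : y - x = (y - 2 * m%:~R) - (x - 2 * m%:~R)); last by ring.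
    by apply: signed_upper_lipschitz; lra.
  + rewrite mE in ix; rewrite -[i.+1%:R]natr1 addrA mE in yi.
    rewrite -[x](subrKC (2 * m%:~R)) -[y](subrKC (2 * m%:~R)) !itinerary_before; [|lra..].
    rewrite !subrKC (_ : y - x = (y - 2 * m%:~R) - (x - 2 * m%:~R)); last by ring.
    by apply: signed_upper_lipschitz; lra.
- by rewrite addr0.
Qed.

Lemma itinerary_continuous s c b (j : 'I_2) :
  continuous (fun t => itinerary s (c * t + b) 0 j).
Proof.
move=> t; apply/cvgrPdist_lt => e e0.
pose M := 2 * `|c| + 1; have M0 : 0 < M by rewrite /M ltr_wpDl // mulr_ge0.
near=> v; rewrite (le_lt_trans (itinerary_lipschitz _ _ _ _)) //.
rewrite opprD addrACA subrr addr0 -mulrBr normrM mulrA.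
apply: (@le_lt_trans _ _ (M * `|t - v|)); first by rewrite ler_wpM2r // /M lerDl.
rewrite mulrC -ltr_pdivlMr //.
by near: v; apply: cvgr_dist_lt => //; rewrite divr_gt0.
Unshelve. all: by end_near. Qed.

Lemma dist_continuous (g1 g2 : R -> plane R) :
  (forall j, continuous (fun t => g1 t 0 j)) -> (forall j, continuous (fun t => g2 t 0 j)) ->
  continuous (fun t => dist (g1 t) (g2 t)).
Proof.
move=> c1 c2 t; rewrite /dist.
apply: (@continuous_comp _ _ _ (fun t => dot (g1 t - g2 t) (g1 t - g2 t)) (@Num.sqrt R));
  last exact: sqrt_continuous.
rewrite (_ : (fun t => _) = fun t => (g1 t 0 0 - g2 t 0 0) * (g1 t 0 0 - g2 t 0 0) +
   (g1 t 0 1 - g2 t 0 1) * (g1 t 0 1 - g2 t 0 1)); last first.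
  by apply/funext => v; rewrite dotE !mxE.
have cB j : {for t, continuous (fun t => g1 t 0 j - g2 t 0 j)}.
  by apply: continuousB; [exact: c1|exact: c2].
by apply: continuousD; apply: continuousM; exact: cB.
Qed.

Lemma dist_figure p q : figure_eight p -> figure_eight q -> dist p q <= 4.
Proof.
have M p' (j : 'I_2) : figure_eight p' -> -1 <= p' 0 j <= 1.
  move=> [x1 y1]; have y2 : p' 0 1 ^+ 2 <= 1.
    by rewrite y1 profileE; have := sqr_ge0 (p' 0 0); nra.
  have [->|j0] := eqVneq j 0; first by apply/andP; split; nra.
  have -> : j = 1 by apply/val_inj; case: j j0 => -[|[]].
  by apply/andP; split; nra.
move=> Mp Mq; rewrite (le_trans (dist_le_coord _ _)) //.
have := (M _ 0 Mp, M _ 1 Mp, M _ 0 Mq, M _ 1 Mq).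
move=> [[[/andP[? ?] /andP[? ?]] /andP[? ?]] /andP[? ?]].
have -> : 4 = 2 + 2 :> R by ring.
by apply: lerD; rewrite ler_norml; apply/andP; split; lra.
Qed.

Lemma iter_F1 i (gam : R -> plane R) : iter i (@F1 R) gam = fun t => gam (t + i%:R).
Proof.
elim: i gam => [|i IH] gam; first by apply/funext => t; rewrite addr0.
by rewrite iterS IH; apply/funext => t; rewrite /F1 -natr1; congr gam; ring.
Qed.

End ItineraryMetric.

Lemma figure_eight_compact (R : realType) : compact (@figure_eight R).
Proof.
(* The factor [1] makes this [is_derive_upper] at speed [1], whence continuity. *)
pose F b (v : R) := orient R b *: upper (1 * v).
have cF b : compact (F b @` `[-1, 1]).
  apply: continuous_compact; last exact: segment_compact.
  apply: continuous_subspaceT => v.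
  by apply/differentiable_continuous/derivable1_diffP; case: (is_derive_upper 1 b v).
suff -> : @figure_eight R = F true @` `[-1, 1] `|` F false @` `[-1, 1].
  exact: compactU.
apply/seteqP; split=> [p M|p [] [v /= vI <-]]; last first.
- by rewrite /F mul1r; apply: upper_in_figure; move: vI; rewrite in_itv.
- by rewrite /F mul1r; apply: upper_in_figure; move: vI; rewrite in_itv.
have [x1 _] := M; have [u [b [k [_ y _]]]] := figure_phase M.
have Fp : (F b @` `[-1, 1]) p.
  exists (orient R b * p 0 0).
    rewrite /= in_itv /= /orient; case: (b); apply/andP; split; nra.
  rewrite /F mul1r; apply/esym/upper_coord; last by rewrite profile_orient.
  by rewrite /orient; case: (b); ring.
by case: b Fp {y}; [left|right].
Qed.

Lemma cvg_add_invn (R : realType) (h k : R) :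
  (fun n : nat => (h + n%:R^-1 * k)%:E) @ \oo --> h%:E.
Proof.
apply: cvg_EFin; first exact: nearW.
rewrite -[X in _ --> X]addr0 -[X in _ --> _ + X](mul0r k).
apply: cvgD; first exact: cvg_cst.
apply: cvgMr_tmp; rewrite -cvg_shiftS; exact: cvg_harmonic.
Qed.

(** * Upper and lower bounds for the spanning numbers *)

Section Entropy.
Variables (R : realType) (c : R) (r : nat).
Hypothesis c2 : 2 <= c.
Let Z := lens c r.
Local Notation W := (Omega Z (@figure_eight R)).
Implicit Types (s : int -> bool) (b t eps : R) (n N : nat).

Let c0 : 0 < c. Proof. by apply: lt_le_trans c2. Qed.

(** The word [f] prescribes the turns from [- k] to [N - k - 1]; the values at the other turns are
    arbitrary. *)
Definition extend_code N (k : int) (f : {ffun 'I_N -> bool}) (i : int) : bool :=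
  if insub `|(i + k)%R|%N is Some j then f j else true.

Lemma extend_codeE N (k : int) (f : {ffun 'I_N -> bool}) (i : int) (lt_ikN : (`|(i + k)%R| < N)%N) :
  extend_code k f i = f (Ordinal lt_ikN).
Proof. by rewrite /extend_code insubT. Qed.

(** In the middle half of a turn the abscissa has absolute value at least [1 / 2], so opposite loops
    are at distance at least [1] there. *)
Lemma code_separation N (x x' : {ffun 'I_N -> bool}) (k : 'I_N) (u : R) : x k != x' k ->
  2 * k%:R + 1 / 2 <= u -> u <= 2 * k%:R + 3 / 2 ->
  1 <= `|itinerary (extend_code 0 x) u 0 0 - itinerary (extend_code 0 x') u 0 0|.
Proof.
move=> xk u1 u2.
have codeE (z : {ffun 'I_N -> bool}) : extend_code 0 z k = z k.
  have lt_kN : (`|(k%:Z + 0)%R| < N)%N by rewrite addr0 ltn_ord.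
  by rewrite (extend_codeE _ lt_kN); congr (z _); apply: val_inj; rewrite /= ?addr0 ?addn0.
have iE (z : {ffun 'I_N -> bool}) : itinerary (extend_code 0 z) u 0 0 =
    orient R (z k) * (loop (u - 2 * k%:R)) 0 0.
  by rewrite (@itineraryE _ _ k) ?intrD -?pmulrn; [rewrite mxE codeE|lra..].
have w1 : 1 / 2 <= (loop (u - 2 * k%:R)) 0 0.
  by rewrite /loop; case: ifP => [?|/negbT]; rewrite ?mxE /= -?ltNge; lra.
rewrite !iE -mulrBl; move: xk; rewrite /orient; case: (x k); case: (x' k) => // _.
  by rewrite opprK ger0_norm; lra.
by rewrite -normrN ger0_norm; lra.
Qed.

Lemma code_dist_sum N (x x' : {ffun 'I_N -> bool}) (k : 'I_N) (u : R) p : x k != x' k ->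
  2 * k%:R + 1 / 2 <= u -> u <= 2 * k%:R + 1 / 2 + 1 / 2 + 1 / 2 ->
  1 <= dist p (itinerary (extend_code 0 x) u) + dist p (itinerary (extend_code 0 x') u).
Proof.
move=> xk u1 u2; have sep := @code_separation N x x' k u xk u1.
apply: le_trans (lerD (dist_ge_coord _ _ 0) (dist_ge_coord _ _ 0)).
rewrite distrC (le_trans _ (ler_normD _ _)) // addrA subrK; apply: sep; lra.
Qed.

Lemma rho_itinerary_continuous s1 s2 b1 b2 t1 t2 : continuous (fun t : R =>
  dist (itinerary s1 (c * (t + t1) + b1)) (itinerary s2 (c * (t + t2) + b2))).
Proof.
apply: dist_continuous => j.
  rewrite (_ : (fun t => _) = fun t => itinerary s1 (c * t + (c * t1 + b1)) 0 j).
    exact: itinerary_continuous.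
  by apply/funext => t; rewrite mulrDr addrA.
rewrite (_ : (fun t => _) = fun t => itinerary s2 (c * t + (c * t2 + b2)) 0 j).
  exact: itinerary_continuous.
by apply/funext => t; rewrite mulrDr addrA.
Qed.

Lemma dist_itinerary_le s s' b b' t : itinerary s (c * t + b) = itinerary s' (c * t + b) ->
  dist (itinerary s (c * t + b)) (itinerary s' (c * t + b')) <= 4 * `|b - b'|.
Proof.
move=> ->; rewrite (le_trans (dist_le_coord _ _)) //.
have h j := itinerary_lipschitz s' j (c * t + b) (c * t + b').
have := h 0; have := h 1; rewrite opprD addrACA subrr add0r; lra.
Qed.

(** The spanning family takes finitely many initial phases and all words of signs for the turns met
    between the times [- K] and [n + K]. Only the [c n / 2] turns of the orbit segment depend on
    [n]; the phases and the margins make up the constant [A]. *)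
Lemma entropy_upper eps : 0 < eps -> exists A : nat, (0 < A)%N /\ forall n,
  (min_spanning W (@rho R) (@F1 R) eps n <= ((A * 2 ^ Num.truncn (c / 2 * n%:R))%N%:R)%:E)%E.
Proof.
move=> eps0.
(* The tail in [rho_le]: [24] is [6] times the diameter bound [4]. *)
have [K HK] : exists K : nat, 24 * (3 / 4) ^+ K < eps / 2 :> R.
  have := @cvg_expr R (3 / 4); rewrite ger0_norm ?divr_ge0 // => /(_ _)/cvgrPdist_lt.
  have l1 : 3 / 4 < 1 :> R by lra.
  have e0 : 0 < eps / 48 by rewrite divr_gt0.
  move=> /(_ l1 _ e0)[K _ /(_ K (leqnn K))]; rewrite /= sub0r normrN ger0_norm.
    by exists K; lra.
  by rewrite exprn_ge0 // divr_ge0.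
(* The error of phase: the mesh is [2 / (m + 1)], multiplied by [4] in [dist_itinerary_le] and by
   [6] in [rho_le]. *)
have [m Hm] : exists m : nat, 48 / m.+1%:R < eps / 2 :> R.
  exists (Num.bound (96 / eps)); rewrite ltr_pdivrMr // -ltr_pdivrMl ?divr_gt0 //.
  have := @archi_boundP R (96 / eps); rewrite divr_ge0 ?(ltW eps0) // => /(_ isT) h.
  rewrite (_ : _ * 48 = 96 / eps); last by field; rewrite gt_eqF.
  by rewrite (lt_trans h) // ltr_nat.
(* More than the number of turns made in time [K]; the extra [3] absorbs the initial phase and the
   rounding. *)
pose w := Num.bound (c / 2 * K%:R + 3).
have wP : c / 2 * K%:R + 3 < w%:R.
  by apply: archi_boundP; rewrite addr_ge0 // mulr_ge0 // divr_ge0 // ltW.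
exists (m.+1 * 2 ^ (w + w).+1)%N; split; first by rewrite muln_gt0 expn_gt0.
move=> n; set L := Num.truncn _.
have LP : c / 2 * n%:R < L.+1%:R by exact: truncnS_gt.
pose N := ((w + w).+1 + L)%N.
pose f (x : 'I_m.+1 * {ffun 'I_N -> bool}) : R -> plane R :=
  fun t => itinerary (extend_code w%:Z x.2) (c * t + 2 * x.1%:R / m.+1%:R).
have := @min_spanning_le R _ W (@rho R) (@F1 R) eps n _ f.
rewrite card_prod card_ord card_ffun card_bool card_ord /N expnD mulnA; apply.
  by move=> x; exact: itinerary_Omega.
move=> y Wy; have [b [s [/andP[b0 b2] ->]]] := Omega_itinerary c0 Wy.
have m0 : 0 < m.+1%:R :> R by [].
(* The phase [b] is rounded down to the grid of mesh [2 / (m + 1)]. *)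
pose j := Num.truncn (b * m.+1%:R / 2).
have jP : j%:R <= b * m.+1%:R / 2 < j.+1%:R.
  by apply: truncn_itv; rewrite divr_ge0 // mulr_ge0.
have jm : (j < m.+1)%N.
  rewrite -(ltr_nat R); case/andP: jP => jb _; apply: le_lt_trans jb _.
  by rewrite ltr_pdivrMr // mulrC ltr_pM2l.
exists (Ordinal jm, [ffun i : 'I_N => s (i%:Z - w%:Z)]).
rewrite bowen_dist_lt // => i ltin; rewrite !iter_F1 /f /=.
set s' := extend_code _ _; set b' := 2 * j%:R / m.+1%:R.
have bb' : `|b' - b| <= 2 / m.+1%:R.
  rewrite distrC ger0_norm.
    rewrite lerBlDr /b' -mulrDl ler_pdivlMr //.
    by case/andP: jP => _; rewrite -[j.+1%:R]natr1; lra.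
  by rewrite subr_ge0 /b' ler_pdivrMr //; case/andP: jP; lra.
have b'0 : 0 <= b' by rewrite divr_ge0 // mulr_ge0.
have b'2 : b' <= b by rewrite /b' ler_pdivrMr //; case/andP: jP; lra.
apply: (@le_lt_trans _ _ (6 * (8 / m.+1%:R + 4 * (3 / 4) ^+ K))); last first.
  have {}Hm : 6 * (8 / m.+1%:R) < eps / 2 by rewrite mulrA -natrM.
  by rewrite [eps]splitr mulrDr ltrD // mulrA -natrM.
apply: rho_le.
- exact: rho_itinerary_continuous.
- by move=> t; apply: dist_figure; exact: itinerary_in_figure.
- by rewrite divr_ge0.
move=> t /andP[t1 t2].
apply: le_trans (dist_itinerary_le _ _) _; last first.
  by rewrite (_ : 8 / _ = 4 * (2 / m.+1%:R)) ?ler_wpM2l //; ring.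
set u := c * (t + i%:R) + b'.
rewrite /itinerary; set k := Num.floor (u / 2).
have [ku uk] := floor_half u; rewrite -/k intrD in ku uk.
suff -> : s' k = s k by [].
have i0 : 0 <= i%:R :> R by [].
have iN : i%:R + 1 <= n%:R :> R by rewrite natr1 ler_nat.
have ul : - (c * K%:R) <= u.
  have : 0 <= c * (t + i%:R + K%:R) by apply: mulr_ge0; [exact: ltW|lra].
  by rewrite mulrDr /u; lra.
have uu : u <= c * (K%:R + n%:R) + 2.
  have : 0 <= c * (K%:R + n%:R - (t + i%:R)) by apply: mulr_ge0; [exact: ltW|lra].
  by rewrite mulrBr /u; lra.
have kw0 : 0 <= k + w%:Z.
  rewrite -(ler_int R) intrD -pmulrn; lra.
have kwN : k + w%:Z < N%:Z.
  rewrite -(ltr_int R) intrD -!pmulrn /N natrD -[(w + w).+1%:R]natr1 natrD.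
  rewrite -[L.+1%:R]natr1 in LP; lra.
have lt_kwN : (`|(k + w%:Z)%R| < N)%N by rewrite -ltz_nat gez0_abs.
by rewrite /s' (extend_codeE _ lt_kwN) ffunE /= gez0_abs // addrK.
Qed.

(** Words differing at turn [k] give itineraries on opposite loops during that turn. An iterate of
    the time-one map brings a time window of length [1 / (2 c)] from the middle of the turn into
    [[0, 1]], where the [i = 0] term of [rho] detects it. *)
Lemma entropy_lower eps n : 0 < eps -> eps <= 1 / (4 * c) ->
  (((2 ^ Num.truncn (c / 2 * n%:R))%N%:R)%:E <= min_spanning W (@rho R) (@F1 R) eps n)%E.
Proof.
move=> eps0 epsc; set N := Num.truncn _.
pose f (x : {ffun 'I_N -> bool}) : R -> plane R :=
  fun t => itinerary (extend_code 0 x) (c * t + 0).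
have := @min_spanning_ge R _ W (@rho R) (@F1 R) eps n _ f.
rewrite card_ffun card_bool card_ord; apply.
  by move=> x; exact: itinerary_Omega.
move=> y x x' Wy /(bowen_dist_lt _ _ _ _ _ eps0) yx /(bowen_dist_lt _ _ _ _ _ eps0) yx'.
apply/ffunP => k; apply/eqP; apply: contraT => xk.
have [b [sy [_ yE]]] := Omega_itinerary c0 Wy.
(* The middle half of turn [k] is the time window [[a, a + 2 h]]. *)
pose h := 1 / (2 * c); pose a := (2 * k%:R + 1 / 2) / c.
have h0 : 0 < h by rewrite divr_gt0 // mulr_gt0.
have ch : c * h = 1 / 2 by rewrite /h; field; rewrite gt_eqF.
have ca : c * a = 2 * k%:R + 1 / 2 by rewrite /a mulrC divfK // gt_eqF.
have a0 : 0 <= a by rewrite divr_ge0 ?(ltW c0) // addr_ge0 // mulr_ge0.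
have h4 : h <= 1 / 4.
  by rewrite -(ler_pM2l c0) ch (le_trans _ (ler_wpM2r _ c2)) //; lra.
have kn : c * (a + h) < c * n%:R.
  have /andP[Nn _] : N%:R <= c / 2 * n%:R < N.+1%:R.
    by apply: truncn_itv; rewrite mulr_ge0 // divr_ge0 // ltW.
  have : (k : nat)%:R + 1 <= N%:R :> R by rewrite natr1 ler_nat.
  by rewrite mulrDr ch ca; lra.
rewrite ltr_pM2l // in kn.
(* As [2 h <= 1 / 2], the window contains at most one integer in its interior, so one of its two
   halves lies in a single interval [[i, i + 1]]. *)
have [i [a' [aa' ah' ia ai]]] : exists (i : nat) a', [/\ a <= a', a' <= a + h,
    i%:R <= a' & a' + h <= i%:R + 1].
  have /andP[ia ai] := truncn_itv a0; set i := Num.truncn a in ia ai.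
  rewrite -[i.+1%:R]natr1 in ai.
  have [ahi|iah] := leP (a + h) (i%:R + 1); first by exists i, a; split => //; lra.
  by exists i.+1, (a + h); rewrite -[i.+1%:R]natr1; split; lra.
have ltin : (i < n)%N by rewrite -(ltr_nat R); lra.
move: (yx _ ltin) (yx' _ ltin); rewrite !iter_F1 => d1 d2.
pose D (z : {ffun 'I_N -> bool}) t := dist (y (t + i%:R)) (f z (t + i%:R)).
have cD z : continuous (D z) by rewrite /D yE; exact: rho_itinerary_continuous.
have D0 z t : 0 <= D z t by exact: dist_ge0.
have D4 z t : D z t <= 4 by rewrite /D yE; apply: dist_figure; exact: itinerary_in_figure.
have D1 t : a' - i%:R <= t <= a' + h - i%:R -> 1 <= D x t + D x' t.
  move=> /andP[t1 t2].
  have l1 : c * a <= c * (t + i%:R) by rewrite ler_pM2l // (le_trans aa') // -lerBlDr.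
  have l2 : c * (t + i%:R) <= c * (a + h + h).
    rewrite lerBrDr in t2; rewrite ler_pM2l // (le_trans t2) // lerD2r.
    exact: ah'.
  rewrite ca in l1; rewrite !(mulrDr c (_ + h)) (mulrDr c a) ch ca in l2.
  rewrite /D /f addr0; exact: code_dist_sum xk l1 l2.
have p1 : 0 <= a' - i%:R by rewrite subr_ge0.
have p2 : a' - i%:R <= a' + h - i%:R by rewrite lerD2r lerDl ltW.
have p3 : a' + h - i%:R <= 1 by rewrite lerBlDl.
have := rho_sum_ge (cD x) (cD x') (D4 x) (D4 x') p1 p2 p3 D1.
rewrite (_ : _ - _ - _ = h); last by ring.
move=> /le_lt_trans /(_ (ltrD d1 d2)); rewrite ltNge => /negP; case.
(* This is the origin of the threshold on [eps]: a center close to both itineraries would give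
   [h < 2 eps <= h]. *)
rewrite (_ : h = 1 / (4 * c) + 1 / (4 * c)); last by rewrite /h; field; rewrite gt_eqF.
exact: lerD.
Qed.

Lemma lne_ge0_mono (x y : \bar R) : (0 <= x)%E -> (x <= y)%E -> (lne x <= lne y)%E.
Proof.
by move=> x0 xy; rewrite lee_lne // in_itv /= leey andbT // (le_trans x0).
Qed.

(** After division by [n], the rounding of [c n / 2] and the constant [A] contribute only [ln 2 / n]
    and [ln A / n], so the bounds squeeze a genuine limit that is the same for every small [eps]. *)
Lemma entropy_at_lens eps : 0 < eps -> eps <= 1 / (4 * c) ->
  entropy_at W (@rho R) (@F1 R) eps = (c / 2 * ln 2)%:E.
Proof.
move=> eps0 epsc; have [A [A0 upper]] := entropy_upper eps0.
have ln2 : 0 < ln 2 :> R by rewrite ln_gt0 // ltr1n.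
set h := c / 2 * ln 2.
have lnP B n : (0 < B)%N -> ln ((B * 2 ^ Num.truncn (c / 2 * n%:R))%N%:R : R) =
    ln B%:R + (Num.truncn (c / 2 * n%:R))%:R * ln 2.
  by move=> B0; rewrite natrM natrX lnM ?posrE ?ltr0n ?exprn_gt0 // lnXn // mulr_natl.
have trP n : n%:R * h - ln 2 <= (Num.truncn (c / 2 * n%:R))%:R * ln 2 <= n%:R * h.
  have /andP[l1 l2] : (Num.truncn (c / 2 * n%:R))%:R <= c / 2 * n%:R
      < (Num.truncn (c / 2 * n%:R)).+1%:R.
    by apply: truncn_itv; rewrite mulr_ge0 // divr_ge0 // ltW.
  rewrite (_ : n%:R * h = c / 2 * n%:R * ln 2); last by rewrite /h; ring.
  apply/andP; split; last by rewrite ler_wpM2r // ltW.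
  have l3 : c / 2 * n%:R - 1 <= (Num.truncn (c / 2 * n%:R))%:R.
    by rewrite lerBlDr natr1 ltW.
  by have := ler_wpM2r (ltW ln2) l3; rewrite mulrBl mul1r.
rewrite /entropy_at; set u := (X in limn_esup X).
suff cvgu : u @ \oo --> h%:E by rewrite (cvg_limn_einf_sup cvgu).2.
apply: (@squeeze_cvge _ _ _ _ (fun n => (h - n%:R^-1 * ln 2)%:E) _
  (fun n => (h + n%:R^-1 * ln A%:R)%:E)).
- near=> n.
  have n0 : (0 < n)%N by near: n; exists 1%N.
  have n0' : n%:R != 0 :> R by rewrite pnatr_eq0 -lt0n.
  have lo := entropy_lower n eps0 epsc.
  have up := upper n.
  have ni : 0 <= n%:R^-1 :> R by rewrite invr_ge0.
  apply/andP; split.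
    apply: le_trans (lee_wpmul2l _ (lne_ge0_mono _ lo)); rewrite ?lee_fin //.
    rewrite lne_EFin ?ltr0n ?expn_gt0 // -EFinM lee_fin.
    have := lnP 1%N n isT; rewrite mul1n ln1 add0r => ->.
    have /andP[h1 _] := trP n.
    have := ler_wpM2l ni h1; rewrite mulrBr mulrA mulVf // mul1r; exact.
  apply: le_trans (lee_wpmul2l _ (lne_ge0_mono _ up)) _; rewrite ?lee_fin //.
    by apply: le_trans lo; rewrite lee_fin.
  rewrite lne_EFin ?ltr0n ?muln_gt0 ?A0 ?expn_gt0 // -EFinM lee_fin lnP //.
  have /andP[_ h1] := trP n.
  by rewrite mulrDr addrC lerD2r -(mulKf n0' h) ler_wpM2l.
- rewrite (_ : (fun n => _) = fun n : nat => (h + n%:R^-1 * - ln 2)%:E).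
    exact: cvg_add_invn.
  by apply/funext => n; rewrite mulrN.
- exact: cvg_add_invn.
Unshelve. all: by end_near. Qed.

Lemma lens_entropy : nsvf_entropy Z (@figure_eight R) = (c / 2 * ln 2)%:E.
Proof.
rewrite /nsvf_entropy /map_entropy; apply: lim_near_cst => //.
near=> eps; apply: entropy_at_lens; near: eps.
  exact: nbhs_right_gt.
by apply: nbhs_right_le; rewrite divr_gt0 // mulr_gt0.
Unshelve. all: by end_near. Qed.

End Entropy.

Theorem theorem5p1 (R : realType) (r : nat) (hr : (1 < r)%N)
    (alpha : nat) (halpha : (2 <= alpha)%N) :
  exists (Z : nsvf R r) (M : set (plane R)),
    [/\ M `<=` domain Z, compact M, Z_invariant Z M &
        nsvf_entropy Z M = (ln (alpha%:R : R))%:E].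
Proof.
have ln2 : 0 < ln 2 :> R by rewrite ln_gt0 // ltr1n.
pose c : R := 2 * ln alpha%:R / ln 2.
have c2 : 2 <= c.
  rewrite /c -mulrA ler_peMr // ler_pdivlMr // mul1r ler_ln ?posrE ?ler_nat ?ltr0n //.
  exact: leq_trans halpha.
exists (lens c r), (@figure_eight R); split => //.
- exact: figure_eight_compact.
- by apply: figure_eight_invariant; exact: lt_le_trans c2.
- by rewrite lens_entropy // /c; congr EFin; field; rewrite gt_eqF.
Qed.
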